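(* For each nonnegative integer $k$, the map $\pi\mapsto\mathrm{DL}_k(\mathrm{swl}(\pi))$ is well defined on $\mathcal U_{2k+1}(132)$ and is a bijection $\mathrm{DL}_k\circ\mathrm{swl}:\mathcal U_{2k+1}(132)\to\mathrm{Int}(\mathcal L_k^T)$.
   Context: Permutations are finite words of distinct positive integers; $S_n$ is the set of permutations of $[n]$. The stack-sorting map $s$: $s(\text{empty})=\text{empty}$, and if $\pi=LnR$ with $n$ the largest entry, $s(\pi)=s(L)s(R)n$. $\pi$ is uniquely sorted if it has exactly one preimage under $s$. A permutation avoids $\tau$ if no subsequence has the same relative order as $\tau$; $\mathcal U_n(\tau)$ is the set of uniquely sorted permutations in $S_n$ avoiding $\tau$. A descent of $\pi$ is an index $i$ with $\pi_i>\pi_{i+1}$; $\mathrm{Des}(\pi)$ is the set of descents. $\mathrm{rev}$ reverses a word, $\pi^{-1}$ is the group inverse, $\mathrm{rot}(\pi)=\mathrm{rev}(\pi^{-1})$, and $\mathrm{rot}^{-1}$ is its inverse. Sliding operators: for $\pi\in S_n$, $i\in[n]$, let $L_i$ (resp. $R_i$) be the set of elements of $[i-1]$ to the left (resp. right) of the entry $i$ in $\pi$. $\mathrm{swu}_i(\pi)$ has $j$-th entry $\pi_j$ if $\pi_j\ge i$, $m$ if $\pi_j$ is the $m$-th smallest element of $R_i$, and $i-m$ if $\pi_j$ is the $m$-th largest element of $L_i$. $\mathrm{swl}_i=\mathrm{rot}^{-1}\circ\mathrm{swu}_i\circ\mathrm{rot}$ and $\mathrm{swl}=\mathrm{swl}_1\circ\cdots\circ\mathrm{swl}_n$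 on $S_n$. Dyck paths: $\mathbf D_k$ is the set of words in $\{U,D\}$ with $k$ of each letter whose every prefix has at least as many $U$'s as $D$'s. Writing $\Lambda=UD^{\gamma_1}\cdots UD^{\gamma_k}$, $\mathrm{lon}_j(\Lambda)$ is the least $t\ge0$ with $\gamma_j+\cdots+\gamma_{j+t}>t$. The Tamari lattice $\mathcal L_k^T$ is $\mathbf D_k$ with $\Lambda\le_T\Lambda'$ iff $\mathrm{lon}_j(\Lambda)\le\mathrm{lon}_j(\Lambda')$ for all $j\in[k]$. $\mathrm{Int}(P)$ is the set of pairs $(x,y)$ with $x\le y$ in $P$. For $\pi\in\mathcal U_{2k+1}(312)$, $n=2k+1$, let $\Lambda_i=D$ if $n-i\in\mathrm{Des}(\pi)$ and $U$ otherwise, $\Lambda'_i=U$ if $i\in\mathrm{Des}(\mathrm{rot}(\pi))$ and $D$ otherwise ($1\le i\le 2k$), and $\mathrm{DL}_k(\pi)=(\Lambda_1\cdots\Lambda_{2k},\Lambda'_1\cdots\Lambda'_{2k})$. *)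

(* Defs.v *)
From mathcomp Require Import all_boot.
From mathcomp Require Import zify.
From mathcomp Require Import classical_sets functions.

Set Implicit Arguments.
Unset Strict Implicit.
Unset Printing Implicit Defensive.

Local Open Scope nat_scope.
Local Open Scope classical_set_scope.

(* Permutations are words w : seq nat.  The entry written w_j in 1-based      *)
(* notation is [nth 0 w j.-1]; the position of the entry x is                 *)
(* [(index x w).+1].                                                          *)
Definition entry (w : seq nat) (j : nat) : nat := nth 0 w j.-1.

Definition is_permutation (w : seq nat) : bool := uniq w && (0 \notin w).

Definition Sym (n : nat) : set (seq nat) := [set w | perm_eq w (iota 1 n)].

(* The first argument is fuel; [stack_sort_nil] and [stack_sort_cat] below    *)
(* are the recursive equations characterizing the map.                        *)
Fixpoint stack_sort_rec (fuel : nat) (w : seq nat) : seq nat :=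
  if fuel is fuel'.+1 then
    if nilp w then [::] else
    let n := \max_(x <- w) x in
    let i := index n w in
    stack_sort_rec fuel' (take i w) ++ stack_sort_rec fuel' (drop i.+1 w)
      ++ [:: n]
  else [::].

Definition stack_sort (w : seq nat) : seq nat := stack_sort_rec (size w) w.

Definition uniquely_sorted (w : seq nat) : Prop :=
  exists! v : seq nat, is_permutation v /\ stack_sort v = w.

Definition same_order (u v : seq nat) : Prop :=
  size u = size v /\
  forall i j, i < size u -> j < size u ->
    (nth 0 u i < nth 0 u j) = (nth 0 v i < nth 0 v j).

Definition avoids (t w : seq nat) : Prop :=
  ~ exists u : seq nat, subseq u w /\ same_order u t.

Definition USort (n : nat) (t : seq nat) : set (seq nat) :=
  [set w | Sym n w /\ uniquely_sorted w /\ avoids t w].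

Definition Des (w : seq nat) : pred nat :=
  [pred i | (0 < i < size w) && (entry w i.+1 < entry w i)].

(* The group inverse of a permutation of [n]: entry j is the position of j.   *)
Definition inv_word (w : seq nat) : seq nat :=
  mkseq (fun j => (index j.+1 w).+1) (size w).

Definition rot_word (w : seq nat) : seq nat := rev (inv_word w).

(* The inverse of [rot_word] on permutations of [n]; see [rot_wordK] and      *)
(* [rot_word_invK].                                                           *)
Definition rot_word_inv (w : seq nat) : seq nat := inv_word (rev w).

Definition left_smaller (i : nat) (w : seq nat) : seq nat :=
  [seq x <- take (index i w) w | x < i].

Definition right_smaller (i : nat) (w : seq nat) : seq nat :=
  [seq x <- drop (index i w).+1 w | x < i].

(* As the entries are distinct, an element x of a list s is the m-th smallest *)
(* (resp. largest) one iff exactly m elements y of s satisfy y <= x (resp.    *)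
(* x <= y).                                                                   *)
Definition swu_at (i : nat) (w : seq nat) : seq nat :=
  [seq if i <= x then x
       else if x \in right_smaller i w
            then count (fun y => y <= x) (right_smaller i w)
            else i - count (fun y => x <= y) (left_smaller i w) | x <- w].

Definition swl_at (i : nat) (w : seq nat) : seq nat :=
  rot_word_inv (swu_at i (rot_word w)).

(* swl_1 (swl_2 (... (swl_n w))), where n = size w.                           *)
Definition swl (w : seq nat) : seq nat := foldr swl_at w (iota 1 (size w)).

(* Lattice words: U is encoded by [true] and D by [false].                    *)
Definition up : bool := true.
Definition down : bool := false.

Definition dyck (k : nat) : set (seq bool) :=
  [set w | [/\ count_mem up w = k, count_mem down w = k &
            forall i, count_mem down (take i w) <= count_mem up (take i w)]].

(* Lengths of the maximal (possibly empty) blocks of D's delimited by U's.    *)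
Fixpoint down_runs (w : seq bool) : seq nat :=
  if w is c :: w' then
    let r := down_runs w' in
    if c == up then 0 :: r else (head 0 r).+1 :: behead r
  else [:: 0].

(* The exponents gamma_1, ..., gamma_k of a word U D^gamma_1 ... U D^gamma_k; *)
(* see [dyck_gamma].                                                          *)
Definition gamma (w : seq bool) : seq nat := behead (down_runs w).

(* For a Dyck path of semilength k and j in [k] the search always succeeds;   *)
(* see [lonP].                                                                *)
Definition lon (j : nat) (w : seq bool) : nat :=
  find (fun t => t < \sum_(j <= i < (j + t).+1) entry (gamma w) i)
       (iota 0 (size (gamma w))).

Definition tamari_le (k : nat) (x y : seq bool) : Prop :=
  forall j, 1 <= j <= k -> lon j x <= lon j y.

Definition IntTamari (k : nat) : set (seq bool * seq bool) :=
  [set p | [/\ dyck k p.1, dyck k p.2 & tamari_le k p.1 p.2]].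

Definition DL (k : nat) (w : seq nat) : seq bool * seq bool :=
  let n := 2 * k + 1 in
  ([seq if n - i \in Des w then down else up | i <- iota 1 (2 * k)],
   [seq if i \in Des (rot_word w) then up else down | i <- iota 1 (2 * k)]).

Lemma stack_sort_rec_fuel f g w :
  size w <= f -> size w <= g -> stack_sort_rec f w = stack_sort_rec g w.
Proof.
elim: f g w => [|f IH] [|g] w //=.
- by case: w.
- by case: w.
move=> wf wg; case: ifP => // /negbT w0.
set M := \max_(x <- w) x.
have Mw : index M w < size w.
  rewrite index_mem /M; case: (w) w0 => // a u _.
  elim: u a => [|b u IHu] a; first by rewrite big_seq1 mem_head.
  rewrite big_cons; case: leqP => _; last by rewrite mem_head.
  by rewrite in_cons IHu orbT.
have st : size (take (index M w) w) = index M w by rewrite size_take Mw.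
have sd : size (drop (index M w).+1 w) = size w - (index M w).+1.
  by rewrite size_drop.
by congr (_ ++ (_ ++ _)); apply: IH; rewrite ?st ?sd; lia.
Qed.

Lemma stack_sort_nil : stack_sort [::] = [::].
Proof. by []. Qed.

Lemma stack_sort_cat (L R : seq nat) (n : nat) :
  (forall x, x \in L ++ R -> x < n) ->
  stack_sort (L ++ n :: R) = stack_sort L ++ stack_sort R ++ [:: n].
Proof.
move=> ltn.
have maxE : \max_(x <- L ++ n :: R) x = n.
  apply/eqP; rewrite eqn_leq; apply/andP; split.
    apply/bigmax_leqP_seq => x; rewrite mem_cat in_cons => xw _.
    have [->//|xn] := eqVneq x n.
    by apply/ltnW/ltn; rewrite mem_cat; move: xw; rewrite (negPf xn).
  by apply: (@leq_bigmax_seq _ _ xpredT id); rewrite // mem_cat mem_head orbT.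
have nL : n \notin L.
  by apply/negP => nL; have := ltn n; rewrite mem_cat nL ltnn => /(_ isT).
have iE : index n (L ++ n :: R) = size L.
  by rewrite index_cat (negPf nL) /= eqxx addn0.
have sE : size (L ++ n :: R) = (size L + size R).+1.
  by rewrite size_cat /= addnS.
rewrite {1}/stack_sort sE /= /nilp sE /= maxE iE take_size_cat //.
rewrite drop_cat ltnNge leqnSn /= subSn // subnn /= drop0.
by congr (_ ++ (_ ++ _)); apply: stack_sort_rec_fuel; lia.
Qed.

Section Rotation.
Variables (n : nat) (w : seq nat).
Hypothesis wS : Sym n w.

Let sw : size w = n.
Proof. by rewrite (perm_size wS) size_iota. Qed.

Let uw : uniq w.
Proof. by rewrite (perm_uniq wS) iota_uniq. Qed.

Let mw x : (x \in w) = (0 < x <= n).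
Proof. by rewrite (perm_mem wS) mem_iota add1n ltnS. Qed.

Lemma Sym_rev : Sym n (rev w).
Proof. by rewrite /Sym /mkset perm_rev. Qed.

Lemma Sym_inv_word : Sym n (inv_word w).
Proof.
rewrite /Sym /mkset /inv_word sw.
have u : uniq (mkseq (fun j => (index j.+1 w).+1) n).
  apply/mkseq_uniqP => i j; rewrite !inE => ilt jlt [eqij].
  have iw : i.+1 \in w by rewrite mw.
  have jw : j.+1 \in w by rewrite mw.
  by have := congr1 (nth 0 w) eqij; rewrite !nth_index // => -[].
apply: uniq_perm (iota_uniq _ _) _ => // x.
have sub : {subset mkseq (fun j => (index j.+1 w).+1) n <= iota 1 n}.
  move=> y /mapP[j]; rewrite mem_iota add0n => /andP[_ jn] ->.
  by rewrite mem_iota add1n /= ltnS -[X in _ <= X]sw index_mem mw.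
by have [|_] := uniq_min_size u sub; rewrite ?size_mkseq ?size_iota.
Qed.

Lemma inv_wordK : inv_word (inv_word w) = w.
Proof.
have si : size (inv_word w) = n by rewrite size_mkseq.
apply: (@eq_from_nth _ 0) => [|j]; first by rewrite size_mkseq si sw.
rewrite size_mkseq si => jn; rewrite nth_mkseq ?si //.
have := mem_nth 0 (_ : j < size w); rewrite sw mw => /(_ jn).
case E : (nth 0 w j) => [|x] //= xn.
have -> : j.+1 = nth 0 (inv_word w) x.
  by rewrite nth_mkseq ?sw // -E index_uniq // sw.
rewrite index_uniq ?si //.
by rewrite (perm_uniq Sym_inv_word) iota_uniq.
Qed.

End Rotation.

Lemma rot_wordK n w : Sym n w -> rot_word_inv (rot_word w) = w.
Proof. by move=> wS; rewrite /rot_word_inv revK (inv_wordK wS). Qed.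

Lemma rot_word_invK n w : Sym n w -> rot_word (rot_word_inv w) = w.
Proof.
by move=> wS; rewrite /rot_word (inv_wordK (Sym_rev wS)) revK.
Qed.

Lemma down_runsP w :
  w = nseq (head 0 (down_runs w)) down ++
      flatten [seq up :: nseq c down | c <- gamma w].
Proof.
rewrite /gamma; elim: w => [|[] w IH] //=; last by rewrite -IH.
have : 0 < size (down_runs w) by case: (w) => [|[] ?].
by case: (down_runs w) IH => //= c r <- _.
Qed.

Lemma size_gamma w : size (gamma w) = count_mem up w.
Proof.
suff: size (down_runs w) = (count_mem up w).+1.
  by rewrite /gamma size_behead => ->.
elim: w => [|[] w IH] //=; first by rewrite IH.
by rewrite size_behead IH.
Qed.

Lemma dyck_gamma k w : dyck k w ->
  size (gamma w) = k /\ w = flatten [seq up :: nseq c down | c <- gamma w].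
Proof.
case=> wU _ /(_ 1) pre; split; first by rewrite size_gamma.
rewrite {1}(down_runsP w).
suff -> : head 0 (down_runs w) = 0 by [].
by case: w pre {wU} => [|[] w] /=; rewrite ?take0.
Qed.

Lemma lonP k j w : dyck k w -> 1 <= j <= k ->
  (lon j w < \sum_(j <= i < (j + lon j w).+1) entry (gamma w) i) /\
  forall t, t < \sum_(j <= i < (j + t).+1) entry (gamma w) i -> lon j w <= t.
Proof.
move=> wD /andP[j0 jk].
have [sg wE] := dyck_gamma wD.
case: (wD) => wU wd pre.
set g := gamma w in sg wE *.
pose a t := t < \sum_(j <= i < (j + t).+1) entry g i.
have cU (s : seq nat) : count_mem up (flatten [seq up :: nseq c down | c <- s])
    = size s.
  elim: s => //= c s IH.
  by rewrite count_cat count_nseq IH mul0n.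
have cD (s : seq nat) : count_mem down (flatten [seq up :: nseq c down | c <- s])
    = sumn s.
  by elim: s => //= c s IH; rewrite count_cat count_nseq IH mul1n.
have ak : a (k - j).
  rewrite /a subnKC //.
  have tot : \sum_(1 <= i < k.+1) entry g i = k.
    rewrite big_add1 /= -[RHS]wd wE cD sumnE [RHS](big_nth 0) sg.
    by apply: eq_bigr.
  have := pre (size (flatten [seq up :: nseq c down | c <- take j.-1 g])).
  rewrite {1 2}wE -{2 4}(cat_take_drop j.-1 g) map_cat flatten_cat.
  rewrite take_size_cat // cU cD size_take sg.
  have -> : j.-1 < k by lia.
  rewrite sumnE (big_nth 0) size_take sg.
  have -> : j.-1 < k by lia.
  have -> : \sum_(0 <= i < j.-1) nth 0 (take j.-1 g) i =
            \sum_(1 <= i < j) entry g i.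
    rewrite big_add1; apply: eq_big_nat => i /andP[_ ij].
    by rewrite nth_take.
  move: tot; rewrite (@big_cat_nat _ _ _ j) //=; last by lia.
  by lia.
have hs : has a (iota 0 k).
  by apply/hasP; exists (k - j) => //; rewrite mem_iota; lia.
have lonE : lon j w = find a (iota 0 k) by rewrite /lon -/g sg.
have fk : find a (iota 0 k) < k by rewrite has_find size_iota in hs.
rewrite lonE; split.
  by have := nth_find 0 hs; rewrite nth_iota.
move=> t at_; rewrite leqNgt; apply/negP => tf.
have := before_find 0 tf; rewrite nth_iota ?add0n; last by lia.
by rewrite /a at_.
Qed.

(* Main.v *)
Require Import Defs.
From mathcomp Require Import all_boot.
From mathcomp Require Import zify.
From mathcomp Require Import classical_sets functions.

Set Implicit Arguments.
Unset Strict Implicit.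
Unset Printing Implicit Defensive.

Local Open Scope nat_scope.
Local Open Scope classical_set_scope.

(* classical_sets has a [down] of its own, which shadows the letter D. *)
Local Notation down := Defs.down.

(* A preimage of w under s is a decreasing binary tree with postorder w; w    *)
(* has exactly one iff some such tree is full and each left child exceeds the *)
(* next entry (otherwise a single child can change sides, or a left subtree   *)
(* can be hung below the next leaf).  The tree is then rebuilt by a stack.    *)
(*                                                                            *)
(* Avoiding 132 (resp. 312) means being read off a binary tree t, labelled in *)
(* inorder, in the order right-left-root (resp. left-right-root), and swl     *)
(* turns one reading of t into the other.  Cut t into maximal right chains,   *)
(* in preorder.  The first path records the lengths of the chains and the     *)
(* second one how many steps are taken back between them, which determines t. *)
(* The stack never fails on the right-left-root reading iff every left        *)
(* subtree has at least twice as many nodes as chains.  Since the subtree of  *)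
(* a chain ends when the second path has gone down more often than the first, *)
(* this is a condition on the partial sums of the two paths, equivalent to    *)
(* lon_j <= lon'_j for all j.                                                 *)

(** * Uniquely sorted words *)

Definition descents (w : seq nat) : nat := count negb (pairmap ltn 0 w).

Definition linked (A B : seq nat) : bool := head 0 B < last 0 A.

Lemma descents_cat A B : 0 < head 0 B -> head 0 B != last 0 A ->
  descents (A ++ B) = descents A + linked A B + descents B.
Proof.
case: B => [//|b B] /= b0 ba; rewrite /descents pairmap_cat count_cat /= b0.
by rewrite /linked /=; lia.
Qed.

Lemma descents_rcons A n : all (ltn^~ n) A -> 0 < n ->
  descents (rcons A n) = descents A.
Proof.
move=> An n0; rewrite /descents -cats1 pairmap_cat count_cat /=.
case/lastP: A An => [|A a]; first by rewrite /= n0.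
by rewrite all_rcons last_rcons => /andP[/= -> _] /=; lia.
Qed.

(* The postorder words of the full decreasing binary trees in which each left *)
(* child exceeds the entry read after it.                                     *)
Inductive full : seq nat -> Prop :=
| Full1 n : 0 < n -> full [:: n]
| Full3 A B n : full A -> full B -> linked A B -> all (ltn^~ n) (A ++ B) ->
    full (A ++ B ++ [:: n]).

Lemma full_head w : full w -> 0 < head 0 w.
Proof. by elim=> //= {w} [A B n _] + _ _ _ _; case: A. Qed.

Lemma full_descents3 A B n : full A -> full B -> linked A B ->
  all (ltn^~ n) (A ++ B) ->
  descents (A ++ B ++ [:: n]) = descents A + 1 + descents B.
Proof.
move=> fA fB lAB lt_n; rewrite catA cats1 descents_rcons //; last first.
  by move/full_head: fA lt_n; case: (A) => //= a ? a0 /andP[]; lia.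
rewrite descents_cat ?lAB ?(full_head fB) //.
by move: lAB; rewrite /linked; lia.
Qed.

Lemma full_last w : full w -> all (leq^~ (last 0 w)) w.
Proof.
case=> [n n0|A B n fA fB lAB lt_n]; first by rewrite /= leqnn.
rewrite catA cats1 last_rcons all_rcons leqnn /=.
by apply: sub_all lt_n => x /ltnW.
Qed.

Lemma full_size w : full w -> size w = (descents w).*2.+1.
Proof.
elim=> [n n0|A B n fA sA fB sB lAB lt_n]; first by rewrite /descents /= n0.
by rewrite full_descents3 // !size_cat sA sB /=; lia.
Qed.

Lemma full_take w i : full w -> 0 < i <= size w ->
  i <= (descents (take i w)).*2.+1.
Proof.
move=> fw; elim: fw i => [n n0|A B n fA IA fB IB lAB lt_n] i.
  by move=> /andP[] /=; lia.
rewrite !size_cat /= => ile; rewrite take_cat; case: ltnP => iA.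
  by apply: IA; lia.
have [->|iA'] := eqVneq i (size A).
  by rewrite subnn take0 cats0 (full_size fA).
rewrite take_cat; case: ltnP => iB.
  have hB : head 0 (take (i - size A) B) = head 0 B.
    by have := subn_gt0 (size A) i; case: (B) (i - size A) => [|b B'] [|m] //=; lia.
  have iAB : 0 < i - size A <= size B by lia.
  have := IB _ iAB.
  rewrite descents_cat /linked hB ?(full_head fB) //; last first.
    by move: lAB; rewrite /linked; lia.
  by move: lAB (full_size fA); rewrite /linked => ->; lia.
have [iE|ne] := eqVneq (i - size A - size B) 0.
  rewrite iE take0 cats0 descents_cat ?lAB ?(full_head fB) //.
    by have := full_size fA; have := full_size fB; lia.
  by move: lAB; rewrite /linked; lia.
rewrite [take _ [:: n]]take_oversize /=; last by lia.
by rewrite full_descents3 //; have := full_size fA; have := full_size fB; lia.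
Qed.

Lemma full_cat_size A B A' B' : full A -> full A' -> full B' ->
  linked A' B' -> A ++ B = A' ++ B' -> size A <= size A'.
Proof.
move=> fA fA' fB' lAB' eqAB; rewrite leqNgt; apply/negP => ltA.
pose C := drop (size A') A.
have AE : A = A' ++ C.
  rewrite /C -[LHS](cat_take_drop (size A')); congr (_ ++ _).
  by have := congr1 (take (size A')) eqAB; rewrite !take_cat ltA ltnn subnn take0 cats0.
have B'E : B' = C ++ B by move/eqP: eqAB; rewrite AE -catA eqseq_cat // eqxx => /eqP.
have sC : 0 < size C by rewrite size_drop; lia.
have hC : head 0 B' = head 0 C by rewrite B'E; case: (C) sC.
have := full_take (i := size C) fB'; rewrite B'E take_size_cat // size_cat.
have := full_size fA; rewrite AE descents_cat.
- by rewrite size_cat (full_size fA') /linked -hC -/(linked A' B') lAB'; lia.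
- by rewrite -hC full_head.
- by move: lAB'; rewrite /linked hC; lia.
Qed.

Lemma stack_sort_ind (P : seq nat -> Prop) :
  P [::] ->
  (forall L R n, (forall x, x \in L ++ R -> x < n) -> P L -> P R ->
     P (L ++ n :: R)) ->
  forall v, uniq v -> P v.
Proof.
move=> P0 PS v; have [m] := ubnP (size v); elim: m v => // m IH v.
have [-> //|v0] := eqVneq v [::] => szv uv.
pose M := \max_(x <- v) x.
have Mv : M \in v.
  have : 0 < size v by case: (v) v0.
  have [x xv ->] : exists2 x, x \in v & M = x.
    rewrite /M; elim: (v) v0 => // a u IHu _; rewrite big_cons.
    have [-> |u0] := eqVneq u [::].
      by exists a; rewrite ?mem_head // big_nil maxn0.
    have [x xu ->] := IHu u0; case: (leqP a x) => ax.
      by exists x; rewrite // in_cons xu orbT.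
    by exists a; rewrite ?mem_head.
  by [].
have leM x : x \in v -> x <= M by move=> xv; apply: (@leq_bigmax_seq _ _ xpredT id).
have [L [R vE]] : exists L R : seq nat, v = L ++ M :: R.
  by case/splitPr: Mv => L R; exists L, R.
clearbody M; move: szv uv leM; rewrite {}vE.
rewrite size_cat /= => szv uv leM.
move: (uv); rewrite cat_uniq /= => /and4P[uL /norP[ML _] MR uR].
have [ltL ltR] : size L < m /\ size R < m by lia.
apply: PS; [|exact: IH..].
move=> x xLR; rewrite ltn_neqAle leM; last first.
  by move: xLR; rewrite !mem_cat in_cons => /orP[]->; rewrite ?orbT.
rewrite andbT; apply/eqP => xM; move: xLR.
by rewrite xM mem_cat (negPf ML) (negPf MR).
Qed.

Lemma perm_stack_sort v : uniq v -> perm_eq (stack_sort v) v.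
Proof.
elim/stack_sort_ind => {v} [//|L R n lt_n pL pR].
rewrite stack_sort_cat // perm_cat // cats1 perm_rcons.
by rewrite perm_cons.
Qed.

Lemma is_permutation_cat (L R : seq nat) n : is_permutation (L ++ n :: R) ->
  [/\ is_permutation L, is_permutation R & 0 < n].
Proof.
rewrite /is_permutation cat_uniq /= mem_cat in_cons !negb_or.
by move=> /andP[/and3P[-> _ /andP[_ ->]] /and3P[-> n0 ->]]; rewrite lt0n eq_sym.
Qed.

Lemma stack_sort_eq0 v : uniq v -> (stack_sort v == [::]) = (v == [::]).
Proof. by move=> uv; rewrite -!size_eq0 (perm_size (perm_stack_sort uv)). Qed.

Lemma head_stack_sort_gt0 v : is_permutation v -> v != [::] ->
  0 < head 0 (stack_sort v).
Proof.
case/andP=> uv v0; rewrite -(stack_sort_eq0 uv) lt0n.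
case E : (stack_sort v) => [//|a s] _ /=; apply: contraNneq v0 => <-.
by rewrite -(perm_mem (perm_stack_sort uv)) E mem_head.
Qed.

Lemma descents_stack_sort_cat (L R : seq nat) n :
  is_permutation (L ++ n :: R) -> L != [::] -> R != [::] ->
  descents (stack_sort L ++ stack_sort R) =
  descents (stack_sort L) + linked (stack_sort L) (stack_sort R) +
  descents (stack_sort R).
Proof.
move=> pv Ln0 Rn0; have [pL pR n0] := is_permutation_cat pv.
have [uL uR] : uniq L /\ uniq R by case/andP: pL; case/andP: pR.
rewrite descents_cat ?head_stack_sort_gt0 //.
apply/eqP => hl; move: pv => /andP[]; rewrite cat_uniq /= negb_or.
case/and3P=> _ /andP[_ /hasPn dis] _ _.
have hR : head 0 (stack_sort R) \in R.
  rewrite -(perm_mem (perm_stack_sort uR)).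
  move: Rn0; rewrite -(stack_sort_eq0 uR).
  by case: (stack_sort R) => //= ? ?; rewrite mem_head.
have := dis _ hR; rewrite hl -(perm_mem (perm_stack_sort uL)) /=.
move: Ln0; rewrite -(stack_sort_eq0 uL).
by case/lastP: (stack_sort L) => // s a _; rewrite last_rcons mem_rcons mem_head.
Qed.

Lemma stack_sort_descents v : is_permutation v -> v != [::] ->
  (descents (stack_sort v)).*2 < size v /\
  ((descents (stack_sort v)).*2.+1 = size v -> full (stack_sort v)).
Proof.
move=> pv; have uv : uniq v by case/andP: pv.
elim/stack_sort_ind: uv pv => {v} [//|L R n lt_n IL IR] pv _.
have [pL pR n0] := is_permutation_cat pv.
have [uL uR] : uniq L /\ uniq R by case/andP: pL; case/andP: pR.
have psL := perm_stack_sort uL; have psR := perm_stack_sort uR.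
have lt_ns : all (ltn^~ n) (stack_sort L ++ stack_sort R).
  by rewrite (perm_all _ (perm_cat psL psR)); apply/allP.
have dn : descents (stack_sort (L ++ n :: R)) =
    descents (stack_sort L ++ stack_sort R).
  by rewrite stack_sort_cat // catA cats1 descents_rcons.
rewrite dn size_cat /= stack_sort_cat //.
have [L0|Ln0] := eqVneq L [::].
  rewrite {}L0 /= in lt_ns *.
  have [->|Rn0] := eqVneq R [::]; first by split=> // _; exact: Full1.
  by have [lt _] := IR pR Rn0; clear -lt; split; lia.
have [R0|Rn0] := eqVneq R [::].
  rewrite {}R0 cats0 /= in lt_ns *.
  by have [lt _] := IL pL Ln0; clear -lt; split; lia.
have [ltL fL] := IL pL Ln0; have [ltR fR] := IR pR Rn0.
rewrite (descents_stack_sort_cat pv) //; split.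
  by clear -ltL ltR; case: (linked _ _); lia.
case lk : (linked _ _) => szE; last by clear -ltL ltR szE; lia.
by apply: Full3 => //; [apply: fL|apply: fR]; clear -ltL ltR szE; lia.
Qed.

Lemma stack_sort_cat_full (L R A B : seq nat) n : is_permutation (L ++ n :: R) ->
  full A -> full B -> linked A B -> stack_sort L ++ stack_sort R = A ++ B ->
  stack_sort L = A /\ stack_sort R = B.
Proof.
move=> pv fA fB lAB eqAB; have [pL pR n0] := is_permutation_cat pv.
have [uL uR] : uniq L /\ uniq R by case/andP: pL; case/andP: pR.
have szL := perm_size (perm_stack_sort uL).
have szR := perm_size (perm_stack_sort uR).
have dAB : (descents (A ++ B)).*2 = size A + size B.
  rewrite descents_cat ?lAB ?(full_head fB) //.
    by have := full_size fA; have := full_size fB; lia.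
  by move: lAB; rewrite /linked; lia.
have szE : size L + size R = size A + size B.
  by have := congr1 size eqAB; rewrite !size_cat szL szR.
have [L0|Ln0] := eqVneq L [::].
  have [R0|Rn0] := eqVneq R [::].
    by move: szE; rewrite L0 R0 (full_size fA).
  exfalso; have [] := stack_sort_descents pR Rn0.
  by move: eqAB szE dAB; rewrite L0 /= => -> szE dAB lt _; lia.
have [R0|Rn0] := eqVneq R [::].
  exfalso; have [] := stack_sort_descents pL Ln0.
  by move: eqAB szE dAB; rewrite R0 cats0 /= => -> szE dAB lt _; lia.
have [ltL fL] := stack_sort_descents pL Ln0.
have [ltR fR] := stack_sort_descents pR Rn0.
have dLR := descents_stack_sort_cat pv Ln0 Rn0.
rewrite eqAB in dLR.
have [lLR [dL dR]] : linked (stack_sort L) (stack_sort R) /\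
  (descents (stack_sort L)).*2.+1 = size L /\
  (descents (stack_sort R)).*2.+1 = size R.
  by clear -dLR dAB szE ltL ltR; case: (linked _ _) dLR; lia.
have szA : size (stack_sort L) = size A.
  apply/eqP; rewrite eqn_leq; apply/andP; split.
    exact: (full_cat_size (fL dL) fA fB lAB eqAB).
  exact: (full_cat_size fA (fL dL) (fR dR) lLR (esym eqAB)).
by move/eqP: eqAB; rewrite eqseq_cat // => /andP[/eqP-> /eqP->].
Qed.

Lemma split_max v : is_permutation v -> v != [::] ->
  exists L R n, v = L ++ n :: R /\ forall x, x \in L ++ R -> x < n.
Proof.
case/andP=> uv _; elim/stack_sort_ind: uv => {v} // L R n lt_n _ _ _.
by exists L, R, n.
Qed.

Lemma stack_sort_full_inj w v1 v2 : full w ->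
  is_permutation v1 -> is_permutation v2 ->
  stack_sort v1 = w -> stack_sort v2 = w -> v1 = v2.
Proof.
move=> fw; elim: fw v1 v2 => [n n0|A B n fA IA fB IB lAB lt_n] v1 v2 p1 p2.
  have [u1 u2] : uniq v1 /\ uniq v2 by case/andP: p1; case/andP: p2.
  move=> s1 s2; have := perm_stack_sort u1; have := perm_stack_sort u2.
  by rewrite s1 s2 perm_sym => /perm_small_eq-> // + ; rewrite perm_sym => /perm_small_eq->.
have dec v : is_permutation v -> stack_sort v = A ++ B ++ [:: n] ->
  exists L R, [/\ v = L ++ n :: R, is_permutation L, is_permutation R,
    stack_sort L = A & stack_sort R = B].
  move=> pv; have [->|vn0] := eqVneq v [::].
    by move=> /(congr1 size); rewrite !size_cat /=; lia.
  have [L [R [m [vE lt_m]]]] := split_max pv vn0.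
  rewrite vE stack_sort_cat // !catA !cats1 => /rcons_inj[eqAB mn].
  rewrite vE mn in pv; have [pL pR _] := is_permutation_cat pv.
  have [sL sR] := stack_sort_cat_full pv fA fB lAB eqAB.
  by exists L, R; rewrite mn.
move=> /(dec _ p1)[L1 [R1 [-> pL1 pR1 sL1 sR1]]].
move=> /(dec _ p2)[L2 [R2 [-> pL2 pR2 sL2 sR2]]].
by rewrite (IA _ _ pL1 pL2 sL1 sL2) (IB _ _ pR1 pR2 sR1 sR2).
Qed.

Lemma full_sorted w : full w -> is_permutation w ->
  exists2 v, is_permutation v & stack_sort v = w.
Proof.
elim=> {w} [n n0|A B n fA IA fB IB lAB lt_n] pw.
  by exists [:: n]; rewrite // -[[:: n]]/([::] ++ n :: [::]) stack_sort_cat.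
have pw' : is_permutation (A ++ n :: B).
  rewrite /is_permutation (perm_uniq (_ : perm_eq _ (A ++ B ++ [:: n]))).
    rewrite (perm_mem (_ : perm_eq _ (A ++ B ++ [:: n]))) //.
    by rewrite perm_cat2l cats1 perm_sym perm_rcons.
  by rewrite perm_cat2l cats1 perm_sym perm_rcons.
have [pA pB _] := is_permutation_cat pw'.
have [L pL sL] := IA pA; have [R pR sR] := IB pB.
have [uL uR] : uniq L /\ uniq R by case/andP: pL; case/andP: pR.
have pLA : perm_eq L A by rewrite perm_sym -sL perm_stack_sort.
have pRB : perm_eq R B by rewrite perm_sym -sR perm_stack_sort.
have pLR : perm_eq (L ++ n :: R) (A ++ n :: B).
  by rewrite perm_cat // perm_cons.
exists (L ++ n :: R).
  by rewrite /is_permutation (perm_uniq pLR) (perm_mem pLR).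
rewrite stack_sort_cat ?sL ?sR // => x.
by rewrite (perm_mem (perm_cat pLA pRB)) => /(allP lt_n).
Qed.

Lemma full_uniquely_sorted w : full w -> is_permutation w -> uniquely_sorted w.
Proof.
move=> fw pw; have [v pv sv] := full_sorted fw pw.
by exists v; split=> // v' [pv' sv']; apply: (stack_sort_full_inj fw).
Qed.

(* The root of L becomes the left child of the leaf of R that is read first.  *)
Lemma stack_sort_graft L R : is_permutation L -> L != [::] ->
  is_permutation R -> R != [::] ->
  (forall x, x \in L -> x < head 0 (stack_sort R)) ->
  exists2 v, perm_eq v (L ++ R) & stack_sort v = stack_sort L ++ stack_sort R.
Proof.
move=> pL Ln0 pR; have uR : uniq R by case/andP: pR.
elim/stack_sort_ind: uR pR => {R} // R1 R2 m lt_m I1 I2 pR _.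
have [p1 p2 m0] := is_permutation_cat pR.
have [u1 u2] : uniq R1 /\ uniq R2 by case/andP: p1; case/andP: p2.
rewrite stack_sort_cat // => ltL.
have [R10|R1n0] := eqVneq R1 [::].
  rewrite {}R10 /= in ltL lt_m I1 *.
  have [R20|R2n0] := eqVneq R2 [::].
    rewrite {}R20 /= in ltL lt_m I1 I2 *.
    exists (L ++ [:: m]); first by [].
    by rewrite stack_sort_cat // cats0.
  have hd : head 0 (stack_sort R2 ++ [:: m]) = head 0 (stack_sort R2).
    by move: R2n0; rewrite -(stack_sort_eq0 u2); case: (stack_sort R2).
  rewrite hd in ltL.
  have [v pv sv] := I2 p2 R2n0 ltL.
  exists (m :: v).
    by rewrite perm_sym -[m :: R2]cat1s perm_catCA /= perm_cons perm_sym.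
  rewrite -[m :: v]/([::] ++ m :: v) stack_sort_cat /= ?sv ?catA // => x.
  rewrite (perm_mem pv) mem_cat => /orP[/ltL xlt|/lt_m //].
  apply: ltn_trans xlt (lt_m _ _).
  rewrite -(perm_mem (perm_stack_sort u2)).
  by move: R2n0; rewrite -(stack_sort_eq0 u2); case: (stack_sort R2) => //= *; rewrite mem_head.
have hd t : head 0 (stack_sort R1 ++ t) = head 0 (stack_sort R1).
  by move: R1n0; rewrite -(stack_sort_eq0 u1); case: (stack_sort R1).
rewrite hd in ltL.
have [v pv sv] := I1 p1 R1n0 ltL.
exists (v ++ m :: R2); first by rewrite catA perm_cat2r.
rewrite stack_sort_cat ?sv -?catA // => x.
rewrite mem_cat (perm_mem pv) mem_cat -orbA => /or3P[/ltL xlt|xR|xR]; last 2 first.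
- by apply: lt_m; rewrite mem_cat xR.
- by apply: lt_m; rewrite mem_cat xR orbT.
apply: ltn_trans xlt (lt_m _ _).
rewrite mem_cat -(perm_mem (perm_stack_sort u1)).
by move: R1n0; rewrite -(stack_sort_eq0 u1); case: (stack_sort R1) => //= *; rewrite mem_head.
Qed.

Lemma uniquely_sorted_full w : is_permutation w -> w != [::] ->
  uniquely_sorted w -> full w.
Proof.
move=> pw wn0 [v [[pv sv] unq]].
have {}unq v' : is_permutation v' -> stack_sort v' = w -> v' = v.
  by move=> pv' sv'; apply/esym/unq.
move: wn0; rewrite -sv in unq *.
have uv : uniq v by case/andP: pv.
rewrite stack_sort_eq0 //.
elim/stack_sort_ind: uv pv unq {pw sv} => {v w} // L R n lt_n IL IR pv unq _.
have [pL pR n0] := is_permutation_cat pv.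
have [uL uR] : uniq L /\ uniq R by case/andP: pL; case/andP: pR.
have permP v' : perm_eq v' (L ++ n :: R) -> is_permutation v'.
  by move=> p; rewrite /is_permutation (perm_uniq p) (perm_mem p).
rewrite stack_sort_cat //; rewrite stack_sort_cat // in unq.
have swap v' : perm_eq v' (L ++ R) -> stack_sort v' = stack_sort L ++ stack_sort R ->
    v' = [::].
  move=> p sE.
  have lt_n' x : x \in v' -> x < n by rewrite (perm_mem p); apply: lt_n.
  have pn : perm_eq (n :: v') (L ++ n :: R).
    by rewrite perm_sym -[n :: R]cat1s perm_catCA /= perm_cons perm_sym.
  have e1 : n :: v' = L ++ n :: R.
    apply: unq; first by apply: permP.
    by rewrite -[n :: v']/([::] ++ n :: v') stack_sort_cat //= sE catA.
  have e2 : v' ++ [:: n] = L ++ n :: R.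
    apply: unq; first by apply: permP; rewrite cats1 perm_rcons.
    by rewrite stack_sort_cat ?cats0 //= sE catA.
  case: v' p e1 e2 lt_n' {sE pn} => // a s _ <- [<-] _ /(_ a).
  by rewrite mem_head ltnn => /(_ isT).
have [L0|Ln0] := eqVneq L [::].
  rewrite L0 /= in swap *.
  by rewrite (swap R) //=; apply: Full1.
have [R0|Rn0] := eqVneq R [::].
  have := swap L; rewrite R0 stack_sort_nil !cats0 => /(_ (perm_refl _) erefl) L0.
  by rewrite L0 in Ln0.
have fL : full (stack_sort L).
  apply: IL => // v' pv' sv'.
  have pp : perm_eq v' L.
    case/andP: pv' => uv' _.
    by rewrite (perm_trans _ (perm_stack_sort uL)) // -sv' perm_sym perm_stack_sort.
  have e : v' ++ n :: R = L ++ n :: R.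
    apply: unq; first by apply: permP; rewrite perm_cat2r.
    rewrite stack_sort_cat ?sv' // => x.
    by rewrite mem_cat (perm_mem pp) -mem_cat; apply: lt_n.
  by move/eqP: e; rewrite eqseq_cat ?(perm_size pp) // => /andP[/eqP].
have fR : full (stack_sort R).
  apply: IR => // v' pv' sv'.
  have pp : perm_eq v' R.
    case/andP: pv' => uv' _.
    by rewrite (perm_trans _ (perm_stack_sort uR)) // -sv' perm_sym perm_stack_sort.
  have e : L ++ n :: v' = L ++ n :: R.
    apply: unq; first by apply: permP; rewrite perm_cat2l perm_cons.
    rewrite stack_sort_cat ?sv' // => x.
    by rewrite mem_cat (perm_mem pp) -mem_cat; apply: lt_n.
  by move/eqP: e; rewrite eqseq_cat // => /andP[_ /eqP[]].
apply: Full3 => //; last first.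
  rewrite (perm_all _ (perm_cat (perm_stack_sort uL) (perm_stack_sort uR))).
  exact/allP.
rewrite /linked ltnNge; apply/negP => lelh.
have [v pv' sv] : exists2 v, perm_eq v (L ++ R)
    & stack_sort v = stack_sort L ++ stack_sort R.
  apply: stack_sort_graft => // x xL.
  have le_x : x <= last 0 (stack_sort L).
    by apply: (allP (full_last fL)); rewrite (perm_mem (perm_stack_sort uL)).
  rewrite ltn_neqAle (leq_trans le_x lelh) andbT; apply/eqP => xE.
  have xR : x \in R.
    rewrite xE -(perm_mem (perm_stack_sort uR)).
    by move/full_head: fR; case: (stack_sort R) => //= *; rewrite mem_head.
  case/andP: pv; rewrite cat_uniq /= negb_or => /and3P[_ /andP[_ /hasPn/(_ _ xR)]].
  by rewrite /= xL.
have v0 := swap v pv' sv.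
by move/perm_size: pv'; rewrite v0 size_cat; case: (L) Ln0.
Qed.

(** * Stacks of full words *)

Definition full_stack (u : seq nat) (ws : seq (seq nat)) : Prop :=
  [/\ flatten ws = u, forall W, W \in ws -> full W & sorted linked ws].

Lemma full_stack1 n : 0 < n -> full_stack [:: n] [:: [:: n]].
Proof. by move=> n0; split=> // W; rewrite inE => /eqP->; apply: Full1. Qed.

Lemma full_stack_last u ws W : full_stack u (rcons ws W) -> last 0 u = last 0 W.
Proof.
case=> <- /(_ W) fW _; rewrite flatten_rcons last_cat.
have /full_head : full W by apply: fW; rewrite mem_rcons mem_head.
by case: W {fW}.
Qed.

Lemma full_stack_head u ws W : full_stack u (W :: ws) -> head 0 u = head 0 W.
Proof.
case=> <- /(_ W) fW _ /=.
have /full_head : full W by apply: fW; rewrite mem_head.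
by case: W {fW}.
Qed.

Lemma full_stack_eq0 u ws : full_stack u ws -> (ws == [::]) = (u == [::]).
Proof.
case=> <- ; case: ws => // W ws /(_ W) fW _ /=.
have /full_head : full W by apply: fW; rewrite mem_head.
by case: W {fW}.
Qed.

Lemma full_stack_cat u v ws vs : full_stack u ws -> full_stack v vs ->
  (u != [::] -> v != [::] -> linked u v) -> full_stack (u ++ v) (ws ++ vs).
Proof.
move=> su sv; rewrite -(full_stack_eq0 su) -(full_stack_eq0 sv).
case: (su) => fu full_u lu; case: (sv) => fv full_v lv luv.
split; first by rewrite flatten_cat fu fv.
  by move=> W; rewrite mem_cat => /orP[/full_u|/full_v].
case/lastP: ws su lu luv {fu full_u} => [//|ws W] su lu.
case: vs sv lv {fv full_v} => [|V vs] sv lv; first by rewrite cats0.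
rewrite cat_rcons -size_eq0 size_rcons => /(_ isT isT) luv.
rewrite sorted_cat_cons lu /=; apply/andP; split=> //.
by move: luv; rewrite /linked (full_stack_last su) (full_stack_head sv).
Qed.

Lemma full_stack_descents u ws : full_stack u ws -> u != [::] ->
  size u + size ws = (descents u).*2.+2.
Proof.
elim/last_ind: ws u => [|ws W IH] u su; first by case: su => <-.
move=> _; case: (su) => uE full_u lu.
have fW : full W by apply: full_u; rewrite mem_rcons mem_head.
have su' : full_stack (flatten ws) ws.
  split=> // [V Vws|]; first by apply: full_u; rewrite mem_rcons in_cons Vws orbT.
  by move: lu; rewrite -cats1; case/cat_sorted2.
have [ws0|ws0] := eqVneq (flatten ws) [::].
  move/eqP: (ws0); rewrite -(full_stack_eq0 su') => /eqP ws1.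
  by rewrite -uE ws1 /= cats0 (full_size fW); lia.
have lk : linked (flatten ws) W.
  case/lastP: ws lu su' ws0 {full_u su IH uE} => // ws V lu su' _.
  rewrite /linked (full_stack_last su').
  by move: lu; rewrite -!cats1 -catA sorted_cat_cons /= => /and3P[].
have := IH _ su' ws0; rewrite -uE flatten_rcons size_cat size_rcons.
rewrite descents_cat ?lk ?(full_head fW) //; first by rewrite (full_size fW); lia.
by move: lk; rewrite /linked; lia.
Qed.

Lemma full_stack_merge u ws n : full_stack u ws -> 1 < size ws ->
  all (ltn^~ n) u ->
  exists2 ws', full_stack (rcons u n) ws' & (size ws').+1 = size ws.
Proof.
case=> uE full_u lu; case/lastP: ws uE full_u lu => // ws B.
case/lastP: ws => // ws A uE full_u lu _ ltn.
have [fA fB] : full A /\ full B.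
  by split; apply: full_u; rewrite !(mem_rcons, inE) eqxx ?orbT.
move: lu; rewrite -!cats1 -catA /= sorted_cat_cons /= => /and3P[lu lAB _].
have fABn : full (A ++ B ++ [:: n]).
  apply: Full3 => //; move: ltn; rewrite -uE !flatten_rcons !all_cat.
  by move=> /andP[/andP[_ ->] ->].
exists (rcons ws (A ++ B ++ [:: n])); last by rewrite !size_cat size_rcons /= ; lia.
split.
- by rewrite -uE !flatten_rcons -!catA.
- move=> W; rewrite mem_rcons inE => /orP[/eqP->//|Wws].
  by apply: full_u; rewrite !(mem_rcons, inE) Wws !orbT.
case/lastP: ws lu {uE full_u ltn} => // ws C.
rewrite -!cats1 -!catA !sorted_cat_cons /= => /and3P[-> + _] /=.
by rewrite !andbT /linked; move/full_head: fA; case: A {fABn lAB}.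
Qed.

Lemma full_stack_full u W : full_stack u [:: W] -> full u.
Proof. by case=> <- /(_ W) fW _; rewrite /= cats0; apply/fW; rewrite mem_head. Qed.

(* The entry after an ascent is an inner node: the two subtrees of this node  *)
(* are read just before it.                                                   *)
Definition ascents_inner (u : seq nat) : Prop :=
  forall p x q, u = p ++ x :: q -> p != [::] -> last 0 p < x ->
  exists C A B, [/\ p = C ++ A ++ B, full A /\ full B, linked A B,
    all (ltn^~ x) (A ++ B) & C != [::] -> linked C A].

Lemma full_ascents_inner w : full w -> ascents_inner w.
Proof.
elim=> [n _|A B n fA IA fB IB lAB lt_n] p x q.
  by case: p => [|a [|b p]].
rewrite !catA cats1; case/lastP: q => [|q y].
  rewrite cats1 => /rcons_inj[<- <-] _ _.
  by exists [::], A, B.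
rewrite -rcons_cons -rcons_cat => /rcons_inj[pxq _] p0 lt_p.
have [pA|Ap] := ltnP (size p) (size A).
  have AE : A = p ++ x :: take (size A - (size p).+1) q.
    have := congr1 (take (size A)) pxq; rewrite take_size_cat // => {1}->.
    rewrite take_cat ltnNge ltnW //=.
    by case: (size A - size p) (subnSK pA) => //= m [->].
  exact: IA AE p0 lt_p.
pose p' := drop (size A) p.
have pE : p = A ++ p'.
  rewrite /p' -[LHS](cat_take_drop (size A)); congr (_ ++ _).
  by have := congr1 (take (size A)) pxq; rewrite take_size_cat // takel_cat // => <-.
move: pxq; rewrite pE -catA => /eqP; rewrite eqseq_cat // eqxx => /eqP BE.
have [p'0|p'0] := eqVneq p' [::].
  move: lt_p lAB; rewrite pE p'0 cats0 BE p'0 /linked /=; lia.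
have lt_p' : last 0 p' < x.
  by move: lt_p; rewrite pE last_cat; case: (p') p'0.
have [C [A1 [B1 [p'E [fA1 fB1] lk lt_x lC]]]] := IB _ _ _ BE p'0 lt_p'.
exists (A ++ C), A1, B1; split=> //; first by rewrite p'E catA.
move=> _; have [C0|C0] := eqVneq C [::].
  rewrite C0 cats0; move: lAB; rewrite BE p'E C0 /linked /=.
  by move/full_head: fA1; case: (A1).
by have := lC C0; rewrite /linked last_cat; case: (C) C0.
Qed.

Lemma ascents_inner_catl u v : ascents_inner (u ++ v) -> ascents_inner u.
Proof. by move=> H p x q uE; apply: (H p x (q ++ v)); rewrite uE -catA. Qed.

Lemma ascents_inner_catr u v : ascents_inner (u ++ v) ->
  (forall x y, x \in u -> y \in v -> y < x) -> ascents_inner v.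
Proof.
move=> H gt_u p x q vE p0 lt_p.
have := H (u ++ p) x q; rewrite vE catA => /(_ erefl).
have -> : u ++ p != [::] by case: (u).
rewrite last_cat; have -> : last (last 0 u) p = last 0 p by case: (p) p0.
move=> /(_ isT lt_p)[C [A [B [pE fAB lAB lt_x lC]]]].
have xv : x \in v by rewrite vE mem_cat mem_head orbT.
have szC : size u <= size C.
  rewrite leqNgt; apply/negP => ltC.
  suff lt_x' : nth 0 u (size C) < x.
    by have := ltn_trans lt_x' (gt_u _ _ (mem_nth 0 ltC) xv); rewrite ltnn.
  have -> : nth 0 u (size C) = head 0 A.
    have := congr1 (nth 0 ^~ (size C)) pE; rewrite !nth_cat ltC ltnn subnn.
    by move=> ->; move/full_head: fAB.1; case: (A).
  apply: (allP lt_x).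
  by move/full_head: fAB.1; case: (A) => //= *; rewrite mem_head.
pose C' := drop (size u) C.
have CE : C = u ++ C'.
  rewrite -[LHS](cat_take_drop (size u)); congr (_ ++ _).
  by have := congr1 (take (size u)) pE; rewrite take_size_cat // takel_cat.
exists C', A, B; split=> //.
  by move/eqP: pE; rewrite CE -catA eqseq_cat // eqxx => /eqP.
by move=> C'0; move: lC; rewrite CE /linked last_cat; case: (C') C'0 => // c s _; apply; case: (u).
Qed.

(** * Binary trees *)

Inductive btree := Leaf | Node of btree & btree.

Definition is_leaf t := if t is Leaf then true else false.

Fixpoint bsize t := if t is Node l r then (bsize l + bsize r).+1 else 0.

Fixpoint post_rl (o : nat) t : seq nat :=
  if t is Node l r then
    post_rl (o + bsize l).+1 r ++ post_rl o l ++ [:: (o + bsize l).+1]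
  else [::].

Fixpoint post_lr (o : nat) t : seq nat :=
  if t is Node l r then
    post_lr o l ++ post_lr (o + bsize l).+1 r ++ [:: (o + bsize l).+1]
  else [::].

(* One entry per maximal right chain, in preorder: for [runs_lo] the number   *)
(* of right edges of the chain, for [runs_hi] the number of steps towards the *)
(* root made along right edges before the next chain starts.                  *)
Fixpoint runs_lo t : seq nat :=
  if t is Node l r then
    if is_leaf r then 0 :: runs_lo l
    else incr_nth (runs_lo r) 0 ++ runs_lo l
  else [::].

Fixpoint runs_hi t : seq nat :=
  if t is Node l r then
    if is_leaf r then 0 :: runs_hi l
    else incr_nth (runs_hi r) (size (runs_hi r)).-1 ++ runs_hi l
  else [::].

(* The reading [post_rl o l] leaves [sumn - size + 2] words on the stack (see *)
(* [left_heavy_stack]), and the parent of l needs two of them.                *)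
Fixpoint left_heavy t : bool :=
  if t is Node l r then
    [&& left_heavy l, left_heavy r & size (runs_lo l) <= sumn (runs_lo l)]
  else true.

Lemma sumn_incr_nth s i : sumn (incr_nth s i) = (sumn s).+1.
Proof.
elim: i s => [|i IH] [|a s] //=; first by rewrite sumn_ncons mul0n.
by rewrite IH; lia.
Qed.

Lemma size_runs_lo_gt0 t : (0 < size (runs_lo t)) = ~~ is_leaf t.
Proof.
by case: t => //= l r; case: ifP => //; rewrite size_cat size_incr_nth; case: ifP => //=; lia.
Qed.

Lemma size_runs_hi t : size (runs_hi t) = size (runs_lo t).
Proof.
elim: t => //= l IHl r IHr; case: ifP => [_|/negbT r0]; first by rewrite /= IHl.
have := size_runs_lo_gt0 r; rewrite r0 => sr.
by rewrite !size_cat !size_incr_nth IHl IHr sr prednK ?sr // leqnn.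
Qed.

Lemma sumn_runs_hi t : sumn (runs_hi t) = sumn (runs_lo t).
Proof.
elim: t => //= l IHl r IHr; case: ifP => _ //=.
by rewrite !sumn_cat !sumn_incr_nth IHl IHr.
Qed.

Lemma size_runs_lo_node l r : ~~ is_leaf r ->
  size (runs_lo (Node l r)) = size (runs_lo r) + size (runs_lo l).
Proof.
move=> r0 /=; rewrite (negPf r0) size_cat size_incr_nth.
by have := size_runs_lo_gt0 r; rewrite r0 => ->.
Qed.

Lemma bsize_runs t : bsize t = size (runs_lo t) + sumn (runs_lo t).
Proof.
elim: t => // l IHl r IHr; have [r0|r0] := boolP (is_leaf r).
  by rewrite /= r0 IHl; case: (r) r0 => //=; lia.
by rewrite size_runs_lo_node //= (negPf r0) sumn_cat sumn_incr_nth IHl IHr; lia.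
Qed.

Lemma iota_node o l r : iota o.+1 (bsize l) ++
  (o + bsize l).+1 :: iota (o + bsize l).+2 (bsize r) =
  iota o.+1 (bsize (Node l r)).
Proof.
by have -> : bsize (Node l r) = bsize l + (bsize r).+1; rewrite ?iotaD ?addSn //= addnS.
Qed.

Lemma perm_post_lr o t : perm_eq (post_lr o t) (iota o.+1 (bsize t)).
Proof.
elim: t o => // l IHl r IHr o; rewrite -iota_node [post_lr _ _]/=.
by rewrite perm_cat // cats1 perm_rcons perm_cons.
Qed.

Lemma perm_post_rl o t : perm_eq (post_rl o t) (iota o.+1 (bsize t)).
Proof.
elim: t o => // l IHl r IHr o; rewrite -iota_node [post_rl _ _]/=.
rewrite perm_catC cats1 cat_rcons perm_cat // perm_cons.
exact: IHr.
Qed.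

Lemma mem_post_lr o t x : (x \in post_lr o t) = (o < x <= o + bsize t).
Proof. by rewrite (perm_mem (perm_post_lr o t)) mem_iota addSn ltnS. Qed.

Lemma mem_post_rl o t x : (x \in post_rl o t) = (o < x <= o + bsize t).
Proof. by rewrite (perm_mem (perm_post_rl o t)) mem_iota addSn ltnS. Qed.

Lemma size_post_rl o t : size (post_rl o t) = bsize t.
Proof. by rewrite (perm_size (perm_post_rl o t)) size_iota. Qed.

Lemma size_post_lr o t : size (post_lr o t) = bsize t.
Proof. by rewrite (perm_size (perm_post_lr o t)) size_iota. Qed.

Lemma post_rl_eq0 o t : (post_rl o t == [::]) = is_leaf t.
Proof. by rewrite -size_eq0 size_post_rl; case: t. Qed.

Lemma post_rl_gt o l r x y : x \in post_rl (o + bsize l).+1 r ->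
  y \in post_rl o l ++ [:: (o + bsize l).+1] -> y < x.
Proof. by rewrite mem_cat !mem_post_rl inE; lia. Qed.

Lemma head_mem (s : seq nat) : s != [::] -> head 0 s \in s.
Proof. by case: s => //= a s; rewrite mem_head. Qed.

Lemma last_mem (s : seq nat) : s != [::] -> last 0 s \in s.
Proof. by case/lastP: s => //= s a; rewrite last_rcons mem_rcons mem_head. Qed.

Lemma left_heavy_stack o t : left_heavy t ->
  exists2 ws, full_stack (post_rl o t) ws &
    size ws + size (runs_lo t) = sumn (runs_lo t) + (~~ is_leaf t).*2.
Proof.
elim: t o => [|l IHl r IHr] o; first by exists [::].
rewrite [left_heavy _]/= => /and3P[hl hr heavy].
have [wl sl szl] := IHl o hl; have [wr sr szr] := IHr (o + bsize l).+1 hr.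
have [ws' s' sz'] : exists2 ws', full_stack (post_rl o l ++ [:: (o + bsize l).+1]) ws'
    & size ws' + size (runs_lo l) = (sumn (runs_lo l)).+1.
  have [l0|l0] := boolP (is_leaf l).
    case: (l) l0 => // _; exists [:: [:: (o + 0).+1]] => //; exact: full_stack1.
  rewrite l0 in szl.
  have lt_x : all (ltn^~ (o + bsize l).+1) (post_rl o l).
    by apply/allP => x; rewrite mem_post_rl /=; lia.
  have ws1 : 1 < size wl by lia.
  have [ws' s' sz'] := full_stack_merge sl ws1 lt_x.
  by exists ws'; rewrite ?cats1 //; lia.
exists (wr ++ ws').
  apply: full_stack_cat => // r0 _; rewrite /linked.
  apply: (post_rl_gt (last_mem r0)); apply: head_mem.
  by rewrite -size_eq0 size_cat addn1.
rewrite size_cat; have [r0|r0] := boolP (is_leaf r).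
  move: szr; rewrite [runs_lo (Node _ _)]/= r0.
  by case: (r) r0 => //= _; lia.
rewrite size_runs_lo_node // /= (negPf r0) sumn_cat sumn_incr_nth.
by rewrite r0 in szr; lia.
Qed.

Lemma ascents_inner_left_heavy o t : ascents_inner (post_rl o t) -> left_heavy t.
Proof.
elim: t o => //= l IHl r IHr o asc.
have ascr := ascents_inner_catl asc.
have ascl := ascents_inner_catr asc (@post_rl_gt o l r).
have hl := IHl _ (ascents_inner_catl ascl).
rewrite (IHr _ ascr) hl /= leqNgt; apply/negP => light.
have [ws sw szw] := left_heavy_stack o hl.
have [l0|l0] := boolP (is_leaf l); first by case: (l) l0 light.
have pl0 : post_rl o l != [::] by rewrite post_rl_eq0.
have lt_x : last 0 (post_rl o l) < (o + bsize l).+1.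
  by have := last_mem pl0; rewrite mem_post_rl; lia.
have := ascl _ _ [::] erefl pl0 lt_x.
move=> [C [A [B [wE [fA fB] lAB _ lC]]]].
rewrite l0 in szw.
have ws1 : size ws = 1.
  have : ws != [::] by rewrite (full_stack_eq0 sw).
  by case: (ws) szw => //= *; lia.
case: ws ws1 sw {szw} => // W [] // _ /full_stack_full fW.
have szW := full_size fW; rewrite wE in fW szW.
have dAB : descents (A ++ B) = descents A + 1 + descents B.
  rewrite descents_cat ?lAB ?(full_head fB) //.
  by move: lAB; rewrite /linked; lia.
have [C0|C0] := eqVneq C [::].
  move: szW; rewrite C0 /= dAB size_cat (full_size fA) (full_size fB); lia.
have sC0 : 0 < size C by case: (C) C0.
have := full_take (i := size C) fW; rewrite take_size_cat // => /(_ _).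
have lCA := lC C0.
have hA : head 0 (A ++ B) = head 0 A by move/full_head: fA; case: (A).
move: szW; rewrite descents_cat /linked hA ?(full_head fA) //; last first.
  by move: lCA; rewrite /linked; lia.
rewrite -/(linked C A) lCA dAB !size_cat (full_size fA) (full_size fB) => szW szC.
have szC' : 0 < size C <= size C + ((descents A).*2.+1 + (descents B).*2.+1) by lia.
by have := szC szC'; lia.
Qed.

Lemma full_post_rl o t : full (post_rl o t) ->
  exists l, [/\ t = Node l Leaf, left_heavy l & sumn (runs_lo l) = size (runs_lo l)].
Proof.
move=> ft; have ht := ascents_inner_left_heavy (full_ascents_inner ft).
have t0 : ~~ is_leaf t.
  by rewrite -(post_rl_eq0 o); move/full_head: ft; case: (post_rl o t).
have [ws sw szw] := left_heavy_stack o ht.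
have := full_stack_descents sw; rewrite post_rl_eq0 t0 (full_size ft) => /(_ isT) szd.
case: t ft ht t0 {sw} szw szd => // l r ft /= /and3P[hl _ _] _ szw szd.
have r0 : bsize r = 0.
  have := full_last ft; rewrite /= catA cats1 last_rcons => /allP le_x.
  have := le_x (o + bsize l + bsize r).+1.
  rewrite mem_rcons in_cons mem_cat !mem_post_rl => le_r; lia.
have ws1 : size ws = 1 by lia.
case: r r0 {ft szd} szw => //= _ szw; exists l; split=> //; lia.
Qed.

Lemma left_heavy_full o l : left_heavy l -> sumn (runs_lo l) = size (runs_lo l) ->
  full (post_rl o (Node l Leaf)).
Proof.
move=> hl szl; have ht : left_heavy (Node l Leaf) by rewrite /= hl szl leqnn.
have [ws sw] := left_heavy_stack o ht; rewrite /= => szw.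
have : size ws = 1 by lia.
by case: ws sw {szw} => // W [] // /full_stack_full.
Qed.

(** * Pattern avoidance *)

Lemma avoids132P w : avoids [:: 1; 3; 2] w <->
  forall a b c, subseq [:: a; b; c] w -> a < c -> c < b -> False.
Proof.
split=> [av a b c sw ac cb|H [u [uw [su so]]]].
  apply: av; exists [:: a; b; c]; split=> //; split=> // i j /=.
  by case: i => [|[|[|i]]] //; case: j => [|[|[|j]]] //=; lia.
case: u su so uw => [|a [|b [|c []]]] //= _ so /H.
have := so 0 2 isT isT; have := so 2 1 isT isT => /= -> -> .
by move/(_ isT isT).
Qed.

Lemma avoids312P w : avoids [:: 3; 1; 2] w <->
  forall a b c, subseq [:: a; b; c] w -> b < c -> c < a -> False.
Proof.
split=> [av a b c sw bc ca|H [u [uw [su so]]]].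
  apply: av; exists [:: a; b; c]; split=> //; split=> // i j /=.
  by case: i => [|[|[|i]]] //; case: j => [|[|[|j]]] //=; lia.
case: u su so uw => [|a [|b [|c []]]] //= _ so /H.
have := so 1 2 isT isT; have := so 2 0 isT isT => /= -> -> .
by move/(_ isT isT).
Qed.

Lemma subseq_catP (T : eqType) (s s1 s2 : seq T) : subseq s (s1 ++ s2) ->
  exists t1 t2, [/\ s = t1 ++ t2, subseq t1 s1 & subseq t2 s2].
Proof.
elim: s1 s => [|x s1 IH] s; first by exists [::], s.
case: s => [|y s]; first by exists [::], [::]; split; rewrite ?sub0seq.
rewrite /=; case: eqP => [->|_] /IH [t1 [t2 [sE st1 st2]]].
  by exists (x :: t1), t2; rewrite sE /= eqxx.
exists t1, t2; split=> //.
exact: subseq_trans st1 (subseq_cons _ _).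
Qed.

Lemma subseq3_cat (a b c : nat) s1 s2 : subseq [:: a; b; c] (s1 ++ s2) ->
  [\/ subseq [:: a; b; c] s1, subseq [:: a; b] s1 /\ c \in s2,
      a \in s1 /\ subseq [:: b; c] s2 | subseq [:: a; b; c] s2].
Proof.
case/subseq_catP=> [[|x [|y [|z [|u t1]]]]] [t2 []] //=.
- by move=> ->; constructor 4.
- by move=> [-> <-]; rewrite sub1seq; constructor 3.
- by move=> [-> -> <-]; rewrite sub1seq; constructor 2.
- by move=> [-> -> -> _]; constructor 1.
Qed.

Lemma subseq_mem2 (b c : nat) s : subseq [:: b; c] s -> (b \in s) /\ (c \in s).
Proof. by move/mem_subseq => H; rewrite !H ?inE ?eqxx ?orbT. Qed.

Lemma avoids_post_rl o t : avoids [:: 1; 3; 2] (post_rl o t).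
Proof.
apply/avoids132P; elim: t o => // l IHl r IHr o a b c /= + ac cb.
case/subseq3_cat.
- by move/IHr => /(_ ac cb).
- case=> /subseq_mem2[aR _] cL.
  by have := post_rl_gt aR cL; lia.
- by case=> aR /subseq_mem2[_ cL]; have := post_rl_gt aR cL; lia.
case/subseq3_cat.
- by move/IHl => /(_ ac cb).
- by rewrite inE => -[/subseq_mem2[_]]; rewrite mem_post_rl; lia.
- by case=> _ /size_subseq.
- by move/size_subseq.
Qed.

Lemma avoids_post_lr o t : avoids [:: 3; 1; 2] (post_lr o t).
Proof.
apply/avoids312P; elim: t o => // l IHl r IHr o a b c /= + bc ca.
case/subseq3_cat.
- by move/IHl => /(_ bc ca).
- case=> /subseq_mem2[+ _]; rewrite mem_cat inE !mem_post_lr; lia.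
- by case=> + /subseq_mem2[_]; rewrite mem_cat inE !mem_post_lr; lia.
case/subseq3_cat.
- by move/IHr => /(_ bc ca).
- by rewrite inE => -[/subseq_mem2[_]]; rewrite mem_post_lr; lia.
- by case=> _ /size_subseq.
- by move/size_subseq.
Qed.

Lemma filter_gt_lt (A : seq nat) x : x \notin A ->
  (forall a b, subseq [:: a; b] A -> a < x -> b < x) ->
  A = filter (ltn x) A ++ filter (ltn^~ x) A.
Proof.
elim: A => // a A IH; rewrite in_cons negb_or => /andP[xa xA] H /=.
have [lt_xa|le_ax] := ltnP x a.
  have -> : (a < x) = false by lia.
  rewrite cat_cons -IH // => b c bc; apply: H.
  exact: subseq_trans bc (subseq_cons _ _).
have lt_ax : a < x by lia.
rewrite lt_ax.
have allA : all (ltn^~ x) A.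
  by apply/allP => b bA; apply: (H a) => //=; rewrite eqxx sub1seq.
have -> : filter (ltn x) A = [::].
  by apply/eqP; rewrite -(negbK (_ == _)) -has_filter; apply/hasPn => b /(allP allA) /=; lia.
by rewrite (all_filterP allA).
Qed.

Lemma avoids132_post_rl o m w : perm_eq w (iota o.+1 m) ->
  avoids [:: 1; 3; 2] w -> exists t, post_rl o t = w.
Proof.
move=> + /avoids132P; have [N] := ubnP m; elim: N o m w => // N IH o m w ltm pw av.
case/lastP: w pw av => [|A x] pw av; first by exists Leaf.
have m0 : m = (size A).+1 by rewrite -(size_iota o.+1 m) -(perm_size pw) size_rcons.
have xin : o < x <= o + m.
  have : x \in rcons A x by rewrite mem_rcons mem_head.
  by rewrite (perm_mem pw) mem_iota; lia.
have uw : uniq (rcons A x) by rewrite (perm_uniq pw) iota_uniq.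
move: uw; rewrite rcons_uniq => /andP[xA uA].
have AE : A = filter (ltn x) A ++ filter (ltn^~ x) A.
  apply: filter_gt_lt => // a b ab ax; rewrite ltnNge leq_eqVlt; apply/negP.
  case/orP=> [/eqP xb|xb].
    by move: xA; rewrite xb; case/subseq_mem2: ab => _ ->.
  by apply: (av a b x); rewrite // -cats1 (cat_subseq ab (subseq_refl [:: x])).
have memA y : (y \in A) = (o < y <= o + m) && (y != x).
  have := perm_mem pw y; rewrite mem_rcons in_cons mem_iota.
  by have [->|_] /= := eqVneq y x; rewrite ?(negPf xA) ?andbF ?andbT; lia.
have sub P : forall a b c, subseq [:: a; b; c] (filter P A) -> a < c -> c < b -> False.
  move=> a b c abc; apply: av; apply: (subseq_trans abc).
  exact: subseq_trans (filter_subseq _ _) (subseq_rcons _ _).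
have [r rE] : exists r, post_rl x r = filter (ltn x) A.
  apply: (IH _ (o + m - x)); [lia| |exact: sub].
  apply: uniq_perm; rewrite ?iota_uniq ?filter_uniq // => y.
  by rewrite mem_filter memA mem_iota /=; lia.
have [l lE] : exists l, post_rl o l = filter (ltn^~ x) A.
  apply: (IH _ (x - o).-1); [lia| |exact: sub].
  apply: uniq_perm; rewrite ?iota_uniq ?filter_uniq // => y.
  by rewrite mem_filter memA mem_iota /=; lia.
have xE : (o + bsize l).+1 = x.
  have : size (filter (ltn^~ x) A) = (x - o).-1.
    rewrite -(size_iota o.+1 (x - o).-1); apply: perm_size.
    apply: uniq_perm; rewrite ?iota_uniq ?filter_uniq // => y.
    by rewrite mem_filter memA mem_iota /=; lia.
  by rewrite -lE size_post_rl; lia.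
by exists (Node l r); rewrite /= xE rE lE catA -AE cats1.
Qed.

(** * The sliding operators *)

Definition slide (i : nat) (w : seq nat) : seq nat :=
  let T := take i.-1 w in
  filter (ltn^~ (entry w i)) T ++ filter (ltn (entry w i)) T ++ drop i.-1 w.

Lemma index_filter (T : eqType) (P : pred T) (s : seq T) v : P v -> v \in s ->
  index v (filter P s) = count P (take (index v s) s).
Proof.
move=> Pv; elim: s => //= a s IH; rewrite in_cons [a == v]eq_sym.
have [<-|nav] /= := eqVneq v a; first by rewrite Pv /= eqxx.
by move=> vs; case: (P a); rewrite /= 1?eq_sym ?(negPf nav) IH.
Qed.

Lemma take_index_rev (T : eqType) (x : T) s : uniq s -> x \in s ->
  take (index x (rev s)) (rev s) = rev (drop (index x s).+1 s).
Proof.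
move=> us xs; case/splitPr: xs us => s1 s2; rewrite cat_uniq /= negb_or.
case/and4P=> _ /andP[xs1 _] xs2 _.
rewrite rev_cat rev_cons cat_rcons !index_cat mem_rev (negPf xs1) (negPf xs2) /=.
rewrite !eqxx !addn0 take_size_cat // -cat_rcons drop_size_cat // size_rcons //.
Qed.

Lemma drop_index_rev (T : eqType) (x : T) s : uniq s -> x \in s ->
  drop (index x (rev s)).+1 (rev s) = rev (take (index x s) s).
Proof.
move=> us xs; case/splitPr: xs us => s1 s2; rewrite cat_uniq /= negb_or.
case/and4P=> _ /andP[xs1 _] xs2 _.
rewrite rev_cat rev_cons !index_cat mem_rcons in_cons eqxx /=.
rewrite -cats1 index_cat mem_rev (negPf xs1) (negPf xs2) /=.
by rewrite !eqxx !addn0 take_size_cat // drop_size_cat // size_cat addn1.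
Qed.

Lemma mem_drop_uniq (T : eqType) (s : seq T) x p : uniq s ->
  (x \in drop p s) = (x \in s) && (x \notin take p s).
Proof.
move=> us; rewrite -{2}(cat_take_drop p s) mem_cat.
move: us; rewrite -{1}(cat_take_drop p s) cat_uniq => /and3P[_ /hasPn dis _].
have [/dis xd|_] := boolP (x \in drop p s); last by rewrite orbF andbN.
by rewrite orbT /= xd.
Qed.

Lemma swl_atE n w i : Sym n w -> 0 < i <= n -> swl_at i w = slide i w.
Proof.
move=> wS iin.
have sw : size w = n by rewrite (perm_size wS) size_iota.
have uw : uniq w by rewrite (perm_uniq wS) iota_uniq.
have mw x : (x \in w) = (0 < x <= n) by rewrite (perm_mem wS) mem_iota add1n ltnS.
pose x := entry w i; pose T := take i.-1 w.
have ix : index x w = i.-1 by rewrite index_uniq // sw; lia.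
have xw : x \in w by rewrite /x mem_nth // sw; lia.
have xin : 0 < x <= n by rewrite -mw.
have szT : size T = i.-1 by rewrite size_takel // sw; lia.
have xT : x \notin T by rewrite /T in_take // ix ltnn.
have splitT : count (ltn^~ x) T + count (ltn x) T = i.-1.
  rewrite -szT -(count_predC (ltn^~ x) T); congr (_ + _).
  apply: eq_in_count => y yT /=; have : y != x by apply: contraNneq xT => <-.
  by lia.
pose w' := slide i w.
have pw' : perm_eq w' w.
  rewrite /w' /slide -/x -/T -[X in perm_eq _ X](cat_take_drop i.-1) catA perm_cat2r -/T.
  rewrite -[X in perm_eq X _]/(_ ++ _) perm_sym -(perm_filterC (ltn^~ x)) perm_cat2l.
  apply/permP => P; congr count; apply: eq_in_filter => y yT /=.
  by have : y != x by [apply: contraNneq xT => <-]; lia.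
have w'S : Sym n w' by rewrite /Sym /mkset (perm_trans pw' wS).
suff swuE : rev (swu_at i (rot_word w)) = inv_word w'.
  by rewrite /swl_at /rot_word_inv swuE (inv_wordK w'S).
have si : size (inv_word w) = n by rewrite size_mkseq.
have ui : uniq (inv_word w) by rewrite (perm_uniq (Sym_inv_word wS)) iota_uniq.
have ii : i \in inv_word w.
  by rewrite (perm_mem (Sym_inv_word wS)) mem_iota; lia.
have idx_i : index i (inv_word w) = x.-1.
  have -> : i = nth 0 (inv_word w) x.-1.
    by rewrite nth_mkseq ?prednK ?ix ?prednK ?sw //; lia.
  by rewrite index_uniq // si; lia.
pose pos v := (index v w).+1.
have invE : inv_word w = map pos (iota 1 n).
  by rewrite /inv_word /mkseq sw (iotaDl 1 0) -map_comp.
have rsE : right_smaller i (rot_word w) =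
    filter (ltn^~ i) (rev (map pos (iota 1 x.-1))).
  rewrite /right_smaller /rot_word drop_index_rev // idx_i invE -map_take take_iota.
  by have -> : minn x.-1 n = x.-1 by lia.
have lsE : left_smaller i (rot_word w) =
    filter (ltn^~ i) (rev (map pos (iota x.+1 (n - x)))).
  rewrite /left_smaller /rot_word take_index_rev // idx_i invE -map_drop drop_iota.
  by rewrite prednK ?add1n //; lia.
rewrite /swu_at map_rev revK.
apply: (@eq_from_nth _ 0) => [|j]; first by rewrite size_map !size_mkseq (perm_size pw').
rewrite size_map si => jn; rewrite (nth_map 0) ?si //.
rewrite nth_mkseq ?sw // nth_mkseq ?(perm_size pw') ?sw //.
have : j.+1 \in w by rewrite mw.
move: j.+1 => v {j jn} vw; rewrite rsE lsE.
have vin : 0 < v <= n by rewrite -mw.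
have pv : index v w < n by rewrite -sw index_mem.
have wE : w = T ++ drop i.-1 w by rewrite cat_take_drop.
have vT : (v \in T) = (index v w < i.-1) by rewrite /T in_take.
have szw' : size (filter (ltn^~ x) T) + size (filter (ltn x) T) = i.-1.
  by rewrite !size_filter.
have [le_i|lt_i] := leqP i (index v w).+1.
  have vT' : v \notin T by rewrite vT; lia.
  rewrite /w' /slide -/x -/T !index_cat !mem_filter (negPf vT') !andbF.
  by rewrite addnA szw' {1}wE index_cat (negPf vT') szT.
have {}vT : v \in T by rewrite vT; lia.
have iT : index v T = index v w by rewrite wE index_cat vT.
have takeT m : m <= i.-1 -> take m T = take m w by move=> mi; rewrite /T take_takel.
have uT : uniq T by rewrite take_uniq.
rewrite /w' /slide -/x -/T index_cat [v \in _]mem_filter vT andbT.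
have pos_inj y : 0 < y <= n -> pos v = pos y -> v = y.
  by rewrite -mw => yw [vy]; rewrite -(nth_index 0 vw) vy nth_index.
have := ltngtP v x; case => [lt_vx|lt_xv|vx].
- have -> : (index v w).+1 \in filter (ltn^~ i) (rev (map pos (iota 1 x.-1))).
    rewrite mem_filter /= lt_i mem_rev; apply: (map_f pos).
    by rewrite mem_iota; clear -vin lt_vx; lia.
  rewrite /= index_filter // iT takeT; last by clear -lt_i; lia.
  rewrite count_filter count_rev count_map -size_filter.
  suff pp : perm_eq (filter (ltn^~ x) (take (index v w).+1 w))
      [seq y <- iota 1 x.-1 | preim pos (predI (leq^~ (index v w).+1) (ltn^~ i)) y].
    rewrite -(perm_size pp) (take_nth 0) ?sw // nth_index // filter_rcons /= lt_vx.
    by rewrite size_rcons size_filter.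
  apply: uniq_perm; rewrite ?filter_uniq ?take_uniq ?iota_uniq // => y.
  rewrite !mem_filter mem_iota /= /pos ltnS.
  have [yw|yw] := boolP (y \in w).
    by rewrite in_take //; move: yw; rewrite mw; clear -lt_i xin iin lt_vx; lia.
  have -> : (y \in take (index v w).+1 w) = false.
    by apply: contraNF yw => /mem_take.
  by move: yw; rewrite mw; clear -lt_i xin iin; lia.
- have -> : ((index v w).+1 \in filter (ltn^~ i) (rev (map pos (iota 1 x.-1)))) = false.
    apply/negP; rewrite mem_filter mem_rev => /andP[_ /mapP[y]].
    by rewrite mem_iota => yin /pos_inj; clear -yin lt_xv xin; lia.
  rewrite /= (ltnNge v) (ltnW lt_xv) /= index_cat [v \in _]mem_filter /= lt_xv vT.
  rewrite index_filter // iT takeT; last by clear -lt_i; lia.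
  rewrite count_filter count_rev count_map -size_filter.
  suff pp : perm_eq (filter (ltn x) (drop (index v w) T))
      [seq y <- iota x.+1 (n - x) | preim pos (predI (leq (index v w).+1) (ltn^~ i)) y].
    rewrite -(perm_size pp) !size_filter.
    move: splitT; rewrite -[in X in _ + X](cat_take_drop (index v w) T) count_cat.
    rewrite takeT; last by clear -lt_i; lia.
    by clear -iin; rewrite /=; lia.
  apply: uniq_perm; rewrite ?filter_uniq ?drop_uniq ?iota_uniq // => y.
  rewrite !mem_filter mem_iota /= /pos ltnS mem_drop_uniq // takeT; last by clear -lt_i; lia.
  have [yw|yw] := boolP (y \in w).
    by rewrite /T !in_take //; move: yw; rewrite mw; clear -lt_i xin iin lt_xv; lia.
  have -> : (y \in T) = false.
    by apply: contraNF yw => /mem_take.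
  by move: yw; rewrite mw; clear -lt_i xin iin; lia.
by move: lt_i; rewrite vx ix; clear -iin; lia.
Qed.

Lemma slide_catl i A B : 0 < i <= size A -> slide i (A ++ B) = slide i A ++ B.
Proof.
move=> iA; rewrite /slide /entry nth_cat takel_cat ?drop_cat; last by lia.
have -> : i.-1 < size A by lia.
by rewrite -!catA.
Qed.

Lemma slide_catr i A B : all (fun b => all (ltn^~ b) A) B -> 0 < i <= size B ->
  slide (size A + i) (A ++ B) = A ++ slide i B.
Proof.
move=> ltAB iB; rewrite /slide /entry.
have -> : (size A + i).-1 = size A + i.-1 by lia.
rewrite nth_cat take_cat drop_cat ltnNge leq_addr /= addKn.
have ltA : all (ltn^~ (nth 0 B i.-1)) A.
  have iB' : i.-1 < size B by lia.
  exact: (allP ltAB _ (mem_nth 0 iB')).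
rewrite !filter_cat (all_filterP ltA).
suff -> : filter (ltn (nth 0 B i.-1)) A = [::] by rewrite -catA.
apply/eqP; rewrite -(negbK (_ == _)) -has_filter; apply/hasPn => a /(allP ltA) /=.
by lia.
Qed.

Lemma perm_slide i A : uniq A -> 0 < i <= size A -> perm_eq (slide i A) A.
Proof.
move=> uA iA; rewrite /slide; set T := take _ _; set x := entry A i.
rewrite -[X in perm_eq _ X](cat_take_drop i.-1) catA perm_cat2r -/T.
rewrite perm_sym -(perm_filterC (ltn^~ x)) perm_cat2l.
apply/permP => P; congr count; apply: eq_in_filter => y yT /=.
have : y != x; last by lia.
have iA' : i.-1 < size A by lia.
by apply: contraTneq yT => ->; rewrite /T in_take ?mem_nth // index_uniq // ltnn.
Qed.

Definition slides (w : seq nat) : seq nat := foldr slide w (iota 1 (size w)).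

Lemma foldr_slide_catl s A B : uniq A -> all (fun i => 0 < i <= size A) s ->
  foldr slide (A ++ B) s = foldr slide A s ++ B /\ perm_eq (foldr slide A s) A.
Proof.
move=> uA; elim: s => [_|i s IH /= /andP[iA /IH [-> pA]]]; first by split.
have szA := perm_size pA.
rewrite slide_catl ?szA //; split=> //; apply: (perm_trans _ pA).
by apply: perm_slide; rewrite ?szA // (perm_uniq pA).
Qed.

Lemma foldr_slide_catr s A B : uniq B -> all (fun i => 0 < i <= size B) s ->
  all (fun b => all (ltn^~ b) A) B ->
  foldr slide (A ++ B) (map (addn (size A)) s) = A ++ foldr slide B s.
Proof.
move=> uB + ltAB; elim: s => [|i s IH] //= /andP[iB sB].
have [_ pB] := @foldr_slide_catl s B [::] uB sB.
rewrite IH // slide_catr ?(perm_size pB) //.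
by rewrite (perm_all _ pB).
Qed.

Lemma all_iota1 n : all (fun i => 0 < i <= n) (iota 1 n).
Proof. by apply/allP => i; rewrite mem_iota; lia. Qed.

Lemma slides_cat A B : uniq A -> uniq B -> all (fun b => all (ltn^~ b) A) B ->
  slides (A ++ B) = slides A ++ slides B.
Proof.
move=> uA uB ltAB; rewrite {1}/slides size_cat iotaD foldr_cat addnC iotaDl.
rewrite foldr_slide_catr ?all_iota1 //.
by have [] := @foldr_slide_catl _ A (foldr slide B (iota 1 (size B))) uA (all_iota1 _).
Qed.

Lemma slides_rcons A x : uniq A ->  x \notin A ->
  slides (rcons A x) = rcons (slides (filter (ltn^~ x) A ++ filter (ltn x) A)) x.
Proof.
move=> uA xA; rewrite /slides size_rcons -(addn1 (size A)) iotaD foldr_cat /=.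
rewrite add1n {2}/slide /entry /= nth_rcons ltnn eqxx -cats1.
rewrite take_size_cat // drop_size_cat // catA.
set A' := filter _ A ++ filter _ A.
have pA' : perm_eq A' A.
  rewrite perm_sym -(perm_filterC (ltn^~ x)) /A' perm_cat2l.
  apply/permP => P; congr count; apply: eq_in_filter => y yA /=.
  have : y != x by apply: contraNneq xA => <-.
  by lia.
have [] := @foldr_slide_catl (iota 1 (size A)) A' [:: x].
- by rewrite (perm_uniq pA').
- by rewrite (perm_size pA') all_iota1.
by move=> -> _; rewrite (perm_size pA') cats1.
Qed.

Lemma swl_slides n w : Sym n w -> swl w = slides w.
Proof.
move=> wS; rewrite /swl /slides.
have sw : size w = n by rewrite (perm_size wS) size_iota.
have uw : uniq w by rewrite (perm_uniq wS) iota_uniq.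
have := all_iota1 (size w); elim: (iota _ _) => //= i s IH /andP[iw sin].
rewrite IH //; have [_ p] := @foldr_slide_catl s w [::] uw sin.
apply: (@swl_atE n); last by rewrite -sw.
by rewrite /Sym /mkset (perm_trans p).
Qed.

Lemma slides_post_rl o t : slides (post_rl o t) = post_lr o t.
Proof.
elim: t o => // l IHl r IHr o; rewrite [post_rl _ _]/= [post_lr _ _]/=.
set x := (_ + _).+1.
have ur : uniq (post_rl x r) by rewrite (perm_uniq (perm_post_rl _ _)) iota_uniq.
have ul : uniq (post_rl o l) by rewrite (perm_uniq (perm_post_rl _ _)) iota_uniq.
rewrite catA cats1 slides_rcons; first last.
- by rewrite mem_cat !mem_post_rl /x; lia.
- rewrite cat_uniq ur ul andbT /=; apply/hasPn => y.
  by rewrite !mem_post_rl /x; lia.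
rewrite !filter_cat.
have ltr y : y \in post_rl x r -> x < y by rewrite mem_post_rl; lia.
have ltl y : y \in post_rl o l -> y < x by rewrite mem_post_rl /x; lia.
have -> : filter (ltn^~ x) (post_rl x r) = [::].
  by apply/eqP; rewrite -(negbK (_ == _)) -has_filter; apply/hasPn => y /ltr /=; lia.
have -> : filter (ltn x) (post_rl o l) = [::].
  by apply/eqP; rewrite -(negbK (_ == _)) -has_filter; apply/hasPn => y /ltl /=; lia.
have /all_filterP -> : all (ltn x) (post_rl x r) by apply/allP.
have /all_filterP -> : all (ltn^~ x) (post_rl o l) by apply/allP.
rewrite cats0 /= slides_cat // ?IHl ?IHr -?cats1 -?catA //.
by apply/allP => b /ltr xb; apply/allP => a /ltl /=; lia.
Qed.

(** * The two words of a tree *)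

Fixpoint bits_lo t : seq bool :=
  if t is Node l r then is_leaf r :: bits_lo r ++ bits_lo l else [::].

Fixpoint bits_hi t : seq bool :=
  if t is Node l r then bits_hi r ++ is_leaf r :: bits_hi l else [::].

Definition run_word (g : seq nat) : seq bool :=
  flatten [seq up :: nseq c down | c <- g].

Lemma size_run_word g : size (run_word g) = size g + sumn g.
Proof.
by elim: g => //= c g IH; rewrite size_cat size_nseq -/(run_word g) IH; lia.
Qed.

Lemma bits_hiE t : bits_hi t = run_word (runs_hi t).
Proof.
elim: t => //= l IHl r IHr; have [r0|r0] := boolP (is_leaf r).
  by case: (r) r0 => // _; rewrite /= IHl.
have : 0 < size (runs_hi r) by rewrite size_runs_hi size_runs_lo_gt0.
rewrite IHr IHl /run_word map_cat flatten_cat.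
rewrite -cat_rcons; case/lastP: (runs_hi r) => // s c _; congr (_ ++ _).
rewrite size_rcons /=; elim: s => /= [|d s IHs]; last by rewrite -IHs rcons_cat.
by rewrite !cats0 -cats1; congr (_ :: _); elim: c => //= c ->.
Qed.

Lemma bits_loE t : up :: bits_lo t = rcons (run_word (runs_lo t)) up.
Proof.
elim: t => //= l IHl r IHr; have [r0|r0] := boolP (is_leaf r).
  by case: (r) r0 => // _; rewrite /= -IHl.
have := size_runs_lo_gt0 r; rewrite r0.
move: IHr; case: (runs_lo r) => //= c s [IHr] _; rewrite IHr.
by rewrite cat_rcons IHl /run_word map_cat flatten_cat -catA !rcons_cat.
Qed.

Lemma pairmap_post_lr s o t : s <= o -> rev (pairmap ltn s (post_lr o t)) = bits_lo t.
Proof.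
elim: t s o => // l IHl r IHr s o so; rewrite [post_lr _ _]/= [bits_lo _]/=.
set x := (_ + _).+1.
have lt_x : last s (post_lr o l) < x.
  have [->|l0] := eqVneq (post_lr o l) [::]; first by rewrite /x /=; lia.
  have := last_mem l0; rewrite mem_post_lr /x.
  by case: (post_lr o l) l0 => //= *; lia.
rewrite !pairmap_cat /= catA cats1 rev_rcons rev_cat IHl // IHr ?(ltnW lt_x) //.
congr (_ :: _).
have [r0|r0] := boolP (is_leaf r); first by case: (r) r0.
have r1 : post_lr x r != [::] by rewrite -size_eq0 size_post_lr; case: (r) r0.
have := last_mem r1; rewrite mem_post_lr.
by case: (post_lr x r) r1 => //= *; lia.
Qed.

Lemma index_post_lr o t : bits_hi t =
  [seq index v (post_lr o t) < index v.+1 (post_lr o t) | v <- rev (iota o.+1 (bsize t))].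
Proof.
elim: t o => // l IHl r IHr o.
rewrite -iota_node rev_cat rev_cons cat_rcons map_cat map_cons [bits_hi _]/=.
rewrite [post_lr o (Node _ _)]/=; set x := (o + bsize l).+1.
have iL y : y \in post_lr o l ->
    index y (post_lr o l ++ post_lr x r ++ [:: x]) = index y (post_lr o l).
  by move=> yl; rewrite index_cat yl.
have iR y : y \in post_lr x r ->
    index y (post_lr o l ++ post_lr x r ++ [:: x]) = bsize l + index y (post_lr x r).
  move=> yr; have /negPf yl : y \notin post_lr o l.
    by move: yr; rewrite !mem_post_lr /x; lia.
  by rewrite index_cat yl index_cat yr size_post_lr.
have ix : index x (post_lr o l ++ post_lr x r ++ [:: x]) = bsize l + bsize r.
  rewrite index_cat index_cat !mem_post_lr ltnn !size_post_lr /= eqxx addn0.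
  by have -> : (o < x <= o + bsize l) = false by rewrite /x; lia.
have iend y : x + bsize r < y ->
    index y (post_lr o l ++ post_lr x r ++ [:: x]) = (bsize l + bsize r).+1.
  move=> lt_y; rewrite memNindex; last first.
    by rewrite !mem_cat inE !mem_post_lr /x; move: lt_y; rewrite /x; lia.
  by rewrite !size_cat !size_post_lr /=; lia.
have ltr y : y \in post_lr x r -> index y (post_lr x r) < bsize r.
  by rewrite -index_mem size_post_lr.
have ltl y : y \in post_lr o l -> index y (post_lr o l) < bsize l.
  by rewrite -index_mem size_post_lr.
congr (_ ++ _ :: _).
- rewrite (IHr x); apply/eq_in_map => v; rewrite mem_rev mem_iota => vin.
  have vr : v \in post_lr x r by rewrite mem_post_lr; lia.
  rewrite (iR _ vr); have [v1|v1] := boolP (v.+1 \in post_lr x r).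
    by rewrite iR // ltn_add2l.
  rewrite iend ?(memNindex v1) ?size_post_lr ?ltr //; first by have := ltr _ vr; lia.
  by move: v1; rewrite mem_post_lr; lia.
- rewrite ix; have [r0|r0] := boolP (is_leaf r).
    by case: (r) r0 iend => // _ ->; rewrite /= ?addn0 ltnSn.
  have x1 : x.+1 \in post_lr x r by rewrite mem_post_lr; case: (r) r0 => //= *; lia.
  by rewrite iR //; have := ltr _ x1; lia.
rewrite (IHl o); apply/eq_in_map => v; rewrite mem_rev mem_iota => vin.
have vl : v \in post_lr o l by rewrite mem_post_lr; lia.
rewrite iL //; have [v1|v1] := boolP (v.+1 \in post_lr o l); first by rewrite iL.
have vx : v.+1 = x by move: v1; rewrite mem_post_lr /x; lia.
by rewrite (memNindex v1) size_post_lr vx ix ltl // ltn_addr // ltl.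
Qed.

Lemma DL_post_lr k l : bsize l = 2 * k ->
  DL k (post_lr 0 (Node l Leaf)) = (run_word (runs_lo l), run_word (runs_hi l)).
Proof.
move=> szl; set w := post_lr 0 _.
have wS : Sym (2 * k + 1) w.
  by have := perm_post_lr 0 (Node l Leaf); rewrite [bsize _]/= szl addn0 -[(2 * k).+1]addn1; apply.
have sw : size w = 2 * k + 1 by rewrite (perm_size wS) size_iota.
have uw : uniq w by rewrite (perm_uniq wS) iota_uniq.
have szlo : size (run_word (runs_lo l)) = 2 * k.
  by rewrite size_run_word -bsize_runs.
have szhi : size (run_word (runs_hi l)) = 2 * k.
  by rewrite size_run_word size_runs_hi sumn_runs_hi -bsize_runs.
congr pair; apply: (@eq_from_nth _ up); rewrite size_map size_iota ?szlo ?szhi // => j jk.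
  rewrite (nth_map 0) ?size_iota // nth_iota //.
  have -> : nth up (run_word (runs_lo l)) j = nth up (bits_lo (Node l Leaf)) j.
    by rewrite /= bits_loE nth_rcons szlo jk.
  rewrite -(pairmap_post_lr _ (leq0n 0)) -/w nth_rev size_pairmap sw; last by lia.
  rewrite (nth_pairmap 0) ?sw; last by lia.
  rewrite /Des inE /= sw /entry.
  have -> : 2 * k + 1 - j.+1 = (2 * k - j.+1).+1 by lia.
  have -> : 0 < (2 * k - j.+1).+1 < 2 * k + 1 by lia.
  rewrite /= ; case: ltngtP => // eqn.
  have := nth_uniq 0 (s := w) (i := (2 * k - j.+1).+1) (j := 2 * k - j.+1).
  by rewrite eqn eqxx sw => /(_ _ _ uw); lia.
rewrite (nth_map 0) ?size_iota // nth_iota //.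
have -> : nth up (run_word (runs_hi l)) j = nth up (bits_hi (Node l Leaf)) j.+1.
  by rewrite /= bits_hiE.
have szT : bsize (Node l Leaf) = 2 * k + 1 by rewrite /= szl; lia.
rewrite (index_post_lr 0) -/w szT (nth_map 0) ?size_rev ?size_iota; last by lia.
rewrite nth_rev size_iota; last by lia.
rewrite nth_iota; last by lia.
rewrite /Des inE /= /rot_word size_rev size_mkseq sw /entry.
have jin : j.+1 < 2 * k + 1 by lia.
rewrite jin /= !nth_rev size_mkseq ?sw; try lia.
rewrite !nth_mkseq ?sw; try lia.
have -> : (2 * k + 1 - j.+2).+1 = 1 + (2 * k + 1 - j.+2) by lia.
have -> : (2 * k + 1 - (0 + j).+1).+1 = (1 + (2 * k + 1 - j.+2)).+1 by lia.
by rewrite ltnS; case: ifP.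
Qed.

Lemma avoids312_full_stack w : uniq w -> 0 \notin w -> avoids [:: 3; 1; 2] w ->
  (forall i, 0 < i <= size w -> i <= (descents (take i w)).*2.+1) ->
  exists ws, full_stack w ws.
Proof.
move=> + + /avoids312P; elim/last_ind: w => [|u x IH] uw w0 av hts; first by exists [::].
move: uw w0; rewrite rcons_uniq mem_rcons in_cons negb_or eq_sym.
case/andP=> xu uu /andP[x0 u0].
have xgt0 : 0 < x by lia.
have [ws su] : exists ws, full_stack u ws.
  apply: IH => // [a b c abc|i /andP[i0 iu]].
    by apply: av; apply: subseq_trans abc (subseq_rcons _ _).
  have := hts i; rewrite size_rcons i0 (leqW iu) -cats1 takel_cat //; exact.
have [->|un0] := eqVneq u [::]; first by exists [:: [:: x]]; apply: full_stack1.
have [lt_x|ge_x] := ltnP (last 0 u) x; last first.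
  exists (ws ++ [:: [:: x]]); rewrite -cats1.
  apply: full_stack_cat su (full_stack1 xgt0) _ => _ _.
  rewrite /linked /= ltn_neqAle ge_x andbT; apply: contraNneq xu => ->.
  exact: last_mem.
have all_lt : all (ltn^~ x) u.
  apply/allP => a au /=; rewrite ltnNge leq_eqVlt; apply/negP => /orP[/eqP xa|lt_xa].
    by rewrite xa au in xu.
  case/lastP: u au lt_x av {IH hts xu uu u0 su un0} => // u b.
  rewrite mem_rcons in_cons last_rcons => /orP[/eqP ab|au] lt_x av; first by lia.
  apply: (av a b x) => //; rewrite -!cats1 -catA.
  by apply: (@cat_subseq _ [:: a] [:: b; x]); rewrite ?sub1seq.
have ws1 : 1 < size ws.
  have := full_stack_descents su un0; have := hts (size u).+1.
  rewrite size_rcons leqnn take_oversize ?size_rcons // descents_rcons //.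
  have aux (a b c : nat) : a < b.*2.+1 -> a + c = b.*2.+2 -> 1 < c by lia.
  move/(_ isT); exact: aux.
by have [ws' su' _] := full_stack_merge su ws1 all_lt; exists ws'.
Qed.

Lemma count_negb_bool (s : seq bool) : count negb s = count_mem down s.
Proof. by apply: eq_count => -[]. Qed.

Lemma full_post_lr k l : bsize l = 2 * k -> dyck k (run_word (runs_lo l)) ->
  full (post_lr 0 (Node l Leaf)).
Proof.
move=> szl [Lup Ldown Lpre]; set w := post_lr 0 _; set L := run_word _ in Lup Ldown Lpre.
have sw : size w = (2 * k).+1 by rewrite size_post_lr /= szl addn0.
have uw : uniq w by rewrite (perm_uniq (perm_post_lr _ _)) iota_uniq.
have szL : size L = 2 * k by rewrite size_run_word -bsize_runs.
have bE : rev (pairmap ltn 0 w) = rcons L up.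
  by rewrite pairmap_post_lr // /L -bits_loE.
have dE i : 0 < i <= size w ->
    descents (take i w) = k - count_mem down (take ((2 * k).+1 - i) L).
  move=> iw.
  have -> : descents (take i w) = count negb (take i (pairmap ltn 0 w)).
    rewrite /descents -[in RHS](cat_take_drop i w) pairmap_cat take_size_cat //.
    by rewrite size_pairmap size_takel //; case/andP: iw.
  rewrite -(revK (pairmap ltn 0 w)) bE take_rev size_rcons szL count_rev.
  rewrite count_negb_bool -cats1 drop_cat szL.
  have cL : count_mem down (take ((2 * k).+1 - i) L) +
      count_mem down (drop ((2 * k).+1 - i) L) = k.
    by rewrite -count_cat cat_take_drop.
  have subE a b : a + b = k -> b = k - a by lia.
  case: ltnP => [_|le_i]; first by rewrite count_cat /= !addn0; exact: subE cL.
  move: cL; rewrite [drop _ L]drop_oversize ?szL //= addn0 => cL.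
  have -> : (2 * k).+1 - i - 2 * k = 0 by lia.
  by rewrite cL subnn.
have hts i : 0 < i <= size w -> i <= (descents (take i w)).*2.+1.
  move=> iw; rewrite dE //; have := Lpre ((2 * k).+1 - i).
  have cs (s : seq bool) : count_mem up s + count_mem down s = size s.
    by rewrite -(count_predC (pred1 up) s); congr (_ + _); apply: eq_count => -[].
  have := cs (take ((2 * k).+1 - i) L); rewrite size_takel ?szL; last by lia.
  have aux a b : a + b = (2 * k).+1 - i -> b <= a -> i <= (k - b).*2.+1 by lia.
  exact: aux.
have [ws su] : exists ws, full_stack w ws.
  apply: avoids312_full_stack => //; first by rewrite mem_post_lr.
  exact: avoids_post_lr.
have wn0 : w != [::] by rewrite -size_eq0 sw.
have := full_stack_descents su wn0.
have := dE (2 * k).+1; rewrite sw leqnn subnn take0 take_oversize ?sw // => -> //=.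
move=> szws; have : size ws = 1 by lia.
by case: ws su {szws} => // W [] // /full_stack_full.
Qed.

(** * Trees and partial sums *)

Definition psum (g : seq nat) (i : nat) : nat := sumn (take i g).

Lemma psum0 g : psum g 0 = 0.
Proof. by rewrite /psum take0. Qed.

Lemma psum_oversize g i : size g <= i -> psum g i = sumn g.
Proof. by move=> gi; rewrite /psum take_oversize. Qed.

Lemma psum_cat s1 s2 i :
  psum (s1 ++ s2) i = psum s1 i + psum s2 (i - size s1).
Proof.
rewrite /psum take_cat; case: ltnP => i1.
  have -> : i - size s1 = 0 by lia.
  by rewrite take0 addn0.
by rewrite sumn_cat [take i s1]take_oversize.
Qed.

Lemma psumS g i : psum g i.+1 = psum g i + nth 0 g i.
Proof.
have [ig|gi] := ltnP i (size g); first by rewrite /psum (take_nth 0) // sumn_rcons.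
by rewrite !psum_oversize ?nth_default ?addn0 //; lia.
Qed.

Lemma psum_mono g i j : i <= j -> psum g i <= psum g j.
Proof.
by move=> /subnKC <-; elim: (j - i) => [|d IH]; rewrite ?addn0 // addnS psumS; lia.
Qed.

Lemma psum_drop g e i : psum (drop e g) i = psum g (e + i) - psum g e.
Proof.
elim: i => [|i IH]; first by rewrite psum0 addn0 subnn.
rewrite addnS !psumS IH nth_drop.
by have := @psum_mono g e (e + i); rewrite leq_addr => /(_ isT); lia.
Qed.

Lemma psum_incr_nth s j i : j < size s -> psum (incr_nth s j) i = (j < i) + psum s i.
Proof.
move=> js; elim: i => [|i IH]; first by rewrite !psum0.
by rewrite !psumS IH nth_incr_nth; case: ltngtP; lia.
Qed.

Lemma psum_runs_lo l r i : ~~ is_leaf r ->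
  psum (runs_lo (Node l r)) i =
  (0 < i) + psum (runs_lo r) i + psum (runs_lo l) (i - size (runs_lo r)).
Proof.
move=> r0 /=; have := size_runs_lo_gt0 r; rewrite (negPf r0) => sr.
by rewrite psum_cat psum_incr_nth // size_incr_nth sr.
Qed.

Lemma psum_runs_hi l r i : ~~ is_leaf r ->
  psum (runs_hi (Node l r)) i =
  (size (runs_lo r) <= i) + psum (runs_hi r) i +
  psum (runs_hi l) (i - size (runs_lo r)).
Proof.
move=> r0 /=; have := size_runs_lo_gt0 r; rewrite (negPf r0) -(size_runs_hi r) => sr.
rewrite psum_cat psum_incr_nth ?size_incr_nth ?prednK ?leqnn //.
Qed.

Lemma psum_runs_le t i : psum (runs_hi t) i <= psum (runs_lo t) i.
Proof.
elim: t i => // l IHl r IHr i; have [r0|r0] := boolP (is_leaf r).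
  by case: (r) r0 => // _ /=; case: i => [|i]; rewrite /psum //= add0n; apply: IHl.
rewrite psum_runs_lo // psum_runs_hi //.
have := size_runs_lo_gt0 r; rewrite r0.
by have := IHr i; have := IHl (i - size (runs_lo r)); lia.
Qed.

Lemma psum_runs_lo_size t i : size (runs_lo t) <= i ->
  psum (runs_lo t) i = sumn (runs_lo t).
Proof. exact: psum_oversize. Qed.

Lemma psum_runs_hi_size t i : size (runs_lo t) <= i ->
  psum (runs_hi t) i = sumn (runs_lo t).
Proof. by move=> ti; rewrite psum_oversize ?sumn_runs_hi ?size_runs_hi. Qed.

Lemma incr_nth_injl i s s' : size s = size s' -> incr_nth s i = incr_nth s' i -> s = s'.
Proof.
move=> ss eqi; apply: (@eq_from_nth _ 0) => // j _.
by have := congr1 (nth 0 ^~ j) eqi; rewrite !nth_incr_nth; lia.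
Qed.

Lemma size_runs_split l r l' r' : ~~ is_leaf r -> ~~ is_leaf r' ->
  runs_lo (Node l r) = runs_lo (Node l' r') ->
  runs_hi (Node l r) = runs_hi (Node l' r') ->
  size (runs_lo r') <= size (runs_lo r).
Proof.
move=> r0 r0' lo hi; rewrite leqNgt; apply/negP => lt_r.
have := congr1 (psum ^~ (size (runs_lo r))) lo; rewrite !psum_runs_lo //.
have := congr1 (psum ^~ (size (runs_lo r))) hi; rewrite !psum_runs_hi // leqnn.
rewrite psum_runs_lo_size // psum_runs_hi_size // subnn !psum0.
have -> : size (runs_lo r) - size (runs_lo r') = 0 by lia.
rewrite !psum0; have := psum_runs_le r' (size (runs_lo r)).
have := size_runs_lo_gt0 r; rewrite r0; lia.
Qed.

Lemma runs_inj t t' : runs_lo t = runs_lo t' -> runs_hi t = runs_hi t' -> t = t'.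
Proof.
elim: t t' => [|l IHl r IHr] [|l' r'] lo hi //.
- by have := size_runs_lo_gt0 (Node l' r'); rewrite -lo.
- by have := size_runs_lo_gt0 (Node l r); rewrite lo.
have head0 a b : ~~ is_leaf b -> 0 < psum (runs_lo (Node a b)) 1.
  by move=> b0; rewrite psum_runs_lo.
have [r0|r0] := boolP (is_leaf r); have [r0'|r0'] := boolP (is_leaf r').
- case: (r) (r') r0 r0' lo hi => // -[] // _ _ /= [lo] [hi].
  by rewrite (IHl _ lo hi).
- have := head0 l' r' r0'; rewrite -lo; case: (r) r0 => // _.
  by rewrite /psum /= take0.
- have := head0 l r r0; rewrite lo; case: (r') r0' => // _.
  by rewrite /psum /= take0.
have szr : size (runs_lo r) = size (runs_lo r').
  apply/eqP; rewrite eqn_leq (size_runs_split r0 r0' lo hi).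
  by rewrite (size_runs_split r0' r0 (esym lo) (esym hi)).
move: lo hi; rewrite /= (negPf r0) (negPf r0') !size_runs_hi -szr => /eqP + /eqP.
have sr : 0 < size (runs_lo r) by rewrite size_runs_lo_gt0.
rewrite !eqseq_cat ?size_incr_nth ?size_runs_hi -?szr //.
move=> /andP[/eqP lor /eqP lol] /andP[/eqP hir /eqP hil].
rewrite (IHl _ lol hil) (IHr r') //; first exact: incr_nth_injl lor.
by apply: incr_nth_injl hir; rewrite !size_runs_hi.
Qed.

Lemma incr_nth_rcons s c : incr_nth (rcons s c) (size s) = rcons s c.+1.
Proof. by elim: s => //= d s ->. Qed.

Lemma runs_surj a b : size a = size b -> sumn a = sumn b ->
  (forall i, psum b i <= psum a i) -> exists2 t, runs_lo t = a & runs_hi t = b.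
Proof.
have [N] := ubnP (size a + sumn a); elim: N a b => // N IH [|x a] [|y b] // leN szab sab dom.
  by exists Leaf.
have [x0|x0] := posnP x.
  have y0 : y = 0 by have := dom 1; rewrite /psum /= !take0 /=; lia.
  have [l lo hi] : exists2 l, runs_lo l = a & runs_hi l = b.
    apply: IH => [||| i]; try by move: leN szab sab; rewrite /= ; lia.
    by have := dom i.+1; rewrite /psum /=; lia.
  by exists (Node l Leaf); rewrite /= ?lo ?hi ?x0 ?y0.
pose a' := x :: a; pose b' := y :: b.
have {}szab : size a' = size b' by [].
have {}sab : sumn a' = sumn b' by [].
have {}leN : size a' + sumn a' < N.+1 by [].
have {}dom i : psum b' i <= psum a' i by exact: dom.
have a1 : 0 < psum a' 1 by rewrite /psum /= take0 addn0.
have eq_end : psum a' (size a') = psum b' (size a').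
  by rewrite (@psum_oversize a') // (@psum_oversize b') ?szab.
have ex_e : exists e, (0 < e) && (psum a' e == psum b' e).
  by exists (size a'); rewrite eq_end eqxx.
have [e /andP[e0 /eqP eqe] min_e] := ex_minnP ex_e.
have le_ea : e <= size a' by apply: min_e; rewrite eq_end eqxx.
have le_eb : e <= size b' by rewrite -szab.
have lt_dom i : 0 < i < e -> psum b' i < psum a' i.
  move=> /andP[i0 ie]; rewrite ltn_neqAle dom andbT; apply/eqP => eqi.
  by have := min_e i; rewrite i0 eqi eqxx => /(_ isT); lia.
pose ar := x.-1 :: take e.-1 a.
pose br := rcons (take e.-1 b') (nth 0 b' e.-1).-1.
have arE : incr_nth ar 0 = take e a'.
  by rewrite /ar /a' -(prednK e0) /= (prednK x0).
have brE : incr_nth br e.-1 = take e b'.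
  have be0 : 0 < nth 0 b' e.-1.
    have : psum b' e = psum b' e.-1 + nth 0 b' e.-1 by rewrite -psumS prednK.
    have := @psum_mono a' e.-1 e (leq_pred _).
    have [e1|e1] := posnP e.-1; first last.
      by have := lt_dom e.-1; rewrite e1 /= ltn_predL e0 => /(_ isT); lia.
    by have e_1 : e = 1 by [lia]; rewrite e1 !psum0 -eqe e_1; lia.
  have sz : size (take e.-1 b') = e.-1 by rewrite size_takel //; lia.
  have -> : take e b' = rcons (take e.-1 b') (nth 0 b' e.-1).
    by rewrite -take_nth ?prednK //; lia.
  by have := incr_nth_rcons (take e.-1 b') (nth 0 b' e.-1).-1; rewrite sz prednK.
have szar : size ar = e.
  by rewrite /= size_takel; [lia|move: le_ea => /=; lia].
have szbr : size br = e.
  by rewrite size_rcons size_takel; lia.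
have par i : i <= e -> psum a' i = (0 < i) + psum ar i.
  move=> ie; rewrite -psum_incr_nth ?szar // arE /psum take_takel //.
have pbr i : i <= e -> psum b' i = (e <= i) + psum br i.
  move=> ie; have := @psum_incr_nth br e.-1 i; rewrite szbr prednK // => /(_ (leqnn _)) <-.
  by rewrite brE /psum take_takel.
have [r rlo rhi] : exists2 t, runs_lo t = ar & runs_hi t = br.
  have sumr : sumn ar = sumn br.
    have := par e (leqnn e); have := pbr e (leqnn e).
    rewrite (@psum_oversize ar) ?szar // (@psum_oversize br) ?szbr // leqnn e0 eqe.
    by lia.
  apply: IH => [|||i] //; last 1 first.
  - have [ie|ei] := ltnP i e; last by rewrite !psum_oversize ?szar ?szbr ?sumr.
    have := par i (ltnW ie); have := pbr i (ltnW ie); rewrite leqNgt ie /= add0n => <-.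
    have [->|i0] := posnP i; first by rewrite !psum0.
    by have := lt_dom i; rewrite i0 ie => /(_ isT); lia.
  - have : sumn ar < sumn a'.
      have := par e (leqnn e); rewrite [psum ar e]psum_oversize ?szar // e0 => pe.
      have := @psum_mono a' e (size a') le_ea.
      by rewrite [psum a' (size a')]psum_oversize // pe; lia.
    by move: leN le_ea; rewrite szar; lia.
  - by rewrite szar szbr.
have [l llo lhi] : exists2 t, runs_lo t = drop e a' & runs_hi t = drop e b'.
  have sumE (c : seq nat) : sumn c = psum c e + sumn (drop e c).
    by rewrite /psum -sumn_cat cat_take_drop.
  have := sumE a'; have := sumE b'; rewrite eqe => sb sa.
  apply: IH => [|||i].
  - by move: leN; rewrite size_drop; lia.
  - by rewrite !size_drop; lia.
  - by lia.
  - by rewrite !psum_drop eqe; apply: leq_sub2r.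
have r0 : ~~ is_leaf r by rewrite -size_runs_lo_gt0 rlo szar.
exists (Node l r); rewrite /= (negPf r0).
  by rewrite rlo llo arE cat_take_drop.
by rewrite rhi lhi szbr brE cat_take_drop.
Qed.

(** * The Tamari order on partial sums *)

(* Every excursion of A above B that starts at i, up to the first e where A   *)
(* falls below B (or up to k), gains at least e - i.                          *)
Definition excursion_gain (A B : nat -> nat) (k i : nat) : Prop :=
  forall e, i < e <= k -> (e = k \/ A e + B i < B e + A i) ->
    (forall t, i < t < e -> B t + A i <= A t + B i) -> e + A i <= i + A e.

Definition tamari_sums (A B : nat -> nat) (k : nat) : Prop :=
  forall i j, i < j <= k -> j + B i <= i + B j ->
    exists2 m, i < m <= j & m + A i <= i + A m.

Section TamariSums.
Variables (A B : nat -> nat) (k : nat).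
Hypotheses (A0 : A 0 = 0) (B0 : B 0 = 0) (Ak : A k = k).
Hypotheses (mA : forall i j, i <= j -> A i <= A j).
Hypotheses (mB : forall i j, i <= j -> B i <= B j).

Lemma tamari_no_crossing e : tamari_sums A B k -> e <= k ->
  exists p, [/\ p <= e, forall c, p <= c < e -> e + A c <= c + A e &
                p = 0 \/ B e + p <= e + B p.-1].
Proof.
move=> tam ek.
pose X c := has (fun m => (c < m) && (m + B c <= c + B m)) (iota 0 e.+1).
have XP c : c < e -> X c -> exists2 m, c < m <= e & m + A c <= c + A m.
  move=> ce /hasP[m]; rewrite mem_iota => me /andP[cm mB'].
  have [|m' /andP[cm' m'm] H] := tam c m _ mB'; first by lia.
  by exists m' => //; lia.
have gain p : (forall c, p <= c < e -> X c) ->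
    forall c, p <= c < e -> e + A c <= c + A e.
  move=> Xp c; have [N] := ubnP (e - c); elim: N c => // N IH c ltN ce.
  have [|m cm H] := XP c _ (Xp c ce); first by lia.
  have [->//|me] := eqVneq e m.
  by have := IH m; lia.
suff [p [pe Xp ex]] : exists p, [/\ p <= e, forall c, p <= c < e -> X c &
    p = 0 \/ ~~ X p.-1].
  exists p; split=> //; first exact: gain.
  case: ex => [->|nX]; first by left.
  have [p0|p0] := posnP p; [by left|right].
  rewrite leqNgt; apply/negP => lt_e; move/negP: nX; apply.
  by apply/hasP; exists e; rewrite ?mem_iota; lia.
have : forall d, d <= e -> (forall c, e - d <= c < e -> X c) \/
    exists p, [/\ p <= e, forall c, p <= c < e -> X c & p = 0 \/ ~~ X p.-1].
  elim=> [|d IH] de; first by left=> c; lia.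
  have [H|] := IH (ltnW de); last by right.
  have [Xd|nXd] := boolP (X (e - d).-1).
    left=> c ce; have [->//|cd] := eqVneq c (e - d).-1.
    by apply: H; lia.
  by right; exists (e - d); split=> //; [lia|right].
case/(_ e (leqnn e)) => [H|//].
by exists 0; split=> //; [move=> c ce; apply: H; lia|left].
Qed.

Lemma tamari_dominated : tamari_sums A B k -> (forall i, i <= k -> B i <= i) ->
  forall i, i <= k -> B i <= A i.
Proof.
move=> tam dB i; have [N] := ubnP i; elim: N i => // N IH i ltN ik.
have [i0|i0] := posnP i; first by rewrite i0 A0 B0.
have [p [pe gain [p0|cross]]] := tamari_no_crossing tam ik.
  by have := gain 0; rewrite p0 i0 A0 => /(_ isT); have := dB i ik; lia.
have := IH p.-1; have := mB (leq_pred p).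
have [p0|p0] := posnP p.
  move: cross; rewrite p0 B0 addn0.
  by have := gain 0; rewrite p0 i0 A0 => /(_ isT); lia.
have [pi|pi] := eqVneq p i.
  by have := @mA p.-1 i; rewrite pi in cross *; lia.
by have := gain p; have := IH p; lia.
Qed.

Lemma tamari_excursion_gain : tamari_sums A B k -> (forall i, i <= k -> A i <= i) ->
  forall i, excursion_gain A B k i.
Proof.
move=> tam dA i e /andP[ie ek] stop above.
have [->|ne] := eqVneq e k; first by have := dA i; lia.
case: stop => [eqek|stop]; first by rewrite eqek eqxx in ne.
have [p [pe gain cross]] := tamari_no_crossing tam ek.
have [pi|ip] := leqP p i; first by apply: gain; lia.
case: cross => [p0|cross]; first by lia.
have := mB (leq_pred p).
have [eqpe|nep] := eqVneq p e.
  have := @mA e.-1 e; rewrite eqpe in cross *.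
  have [e1|e1] := eqVneq e.-1 i.
    by rewrite e1 in cross *; lia.
  by have := above e.-1; lia.
have := gain p; have := above p; lia.
Qed.

Lemma excursion_gain_tamari :
  (forall i, i <= k -> B i <= A i) -> (forall i, i < k -> excursion_gain A B k i) ->
  tamari_sums A B k /\ forall i, i <= k -> A i <= i.
Proof.
move=> dom gain.
have stop i : i < k -> exists e, [/\ i < e <= k, e + A i <= i + A e &
    forall t, i < t < e -> B t + A i <= A t + B i].
  move=> ik.
  pose S e := (i < e) && ((e == k) || (A e + B i < B e + A i)).
  have exS : exists e, S e by exists k; rewrite /S ik eqxx.
  have [e /andP[ie Se] min_e] := ex_minnP exS.
  have ek : e <= k by apply: min_e; rewrite /S ik eqxx.
  have above t : i < t < e -> B t + A i <= A t + B i.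
    move=> /andP[it te]; rewrite leqNgt; apply/negP => lt_t.
    by have := min_e t; rewrite /S it lt_t orbT => /(_ isT); lia.
  exists e; split=> //; first by rewrite ie ek.
  apply: (gain i ik e _ _ above); first by rewrite ie ek.
  by case/orP: Se => [/eqP ->|]; [left|right].
split=> [i j /andP[ij jk] Bij|i].
  have [e [/andP[ie ek] gain_e above]] := stop i (leq_trans ij jk).
  have [je|ej] := ltnP j e; first by exists j; [lia|have := above j; lia].
  by exists e; [lia|].
have [N] := ubnP (k - i); elim: N i => // N IH i ltN ik.
have [->|nik] := eqVneq i k; first by rewrite Ak.
have [|e [ie gain_e _]] := stop i; first by lia.
by have := IH e; lia.
Qed.

End TamariSums.

Lemma excursion_gain_shift A B A' B' a b s k i :
  (forall e, e <= k -> A' (s + e) = a + A e) ->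
  (forall e, e <= k -> B' (s + e) = b + B e) -> i <= k ->
  excursion_gain A' B' (s + k) (s + i) <-> excursion_gain A B k i.
Proof.
move=> eA eB ik; split=> H e ie stop above.
  have := H (s + e); rewrite !eA ?eB; try lia.
  move=> H'; suff : s + e + (a + A i) <= s + i + (a + A e) by lia.
  apply: H'; first by lia.
    by case: stop => [->|stop]; [left|right; lia].
  move=> t tie; have -> : t = s + (t - s) by lia.
  by rewrite eA ?eB; try lia; have := above (t - s); lia.
have [e' eE] : exists e', e = s + e' by exists (e - s); lia.
rewrite {}eE in ie stop above *.
have ek : e' <= k by lia.
suff : e' + A i <= i + A e' by rewrite !eA; lia.
apply: H; first by lia.
  by move: stop; rewrite !eA ?eB //; case=> [|stop]; [left|right]; lia.
move=> t tie; have := above (s + t); rewrite !eA ?eB //; lia.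
Qed.

Lemma excursion_gain0 t : excursion_gain (psum (runs_lo t)) (psum (runs_hi t))
    (size (runs_lo t)) 0 <-> size (runs_lo t) <= sumn (runs_lo t).
Proof.
have [c0|c0] := posnP (size (runs_lo t)); first by rewrite c0; split=> // _ e; lia.
split=> [H|le_c e ie stop above].
  suff : size (runs_lo t) + psum (runs_lo t) 0 <= 0 + psum (runs_lo t) (size (runs_lo t)).
    by rewrite psum0 psum_runs_lo_size // addn0.
  apply: H; [by rewrite c0 leqnn|by left|].
  by move=> i _; rewrite !psum0 !addn0 psum_runs_le.
case: stop => [->|]; first by rewrite !psum0 psum_runs_lo_size //; lia.
by rewrite !psum0; have := psum_runs_le t e; lia.
Qed.

Lemma left_heavy_excursion_gain t : left_heavy t <->
  forall i, 0 < i < size (runs_lo t) ->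
    excursion_gain (psum (runs_lo t)) (psum (runs_hi t)) (size (runs_lo t)) i.
Proof.
elim: t => [|l IHl r IHr]; first by split=> // _ i; rewrite /=; lia.
have lhl : left_heavy l && (size (runs_lo l) <= sumn (runs_lo l)) <->
    forall i, i < size (runs_lo l) ->
    excursion_gain (psum (runs_lo l)) (psum (runs_hi l)) (size (runs_lo l)) i.
  split=> [/andP[hl hvy] i il|H].
    have [->|i0] := posnP i; first exact/excursion_gain0.
    by apply: (IHl.1 hl); rewrite i0.
  apply/andP; split; first by apply/IHl => i /andP[_]; apply: H.
  have [->//|l0] := posnP (size (runs_lo l)).
  by apply/excursion_gain0/H.
have [r0|r0] := boolP (is_leaf r).
  have -> : left_heavy (Node l r) = left_heavy l && (size (runs_lo l) <= sumn (runs_lo l)).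
    by case: (r) r0.
  have sh i : i <= size (runs_lo l) ->
    excursion_gain (psum (runs_lo (Node l r))) (psum (runs_hi (Node l r)))
      (size (runs_lo (Node l r))) i.+1 <->
    excursion_gain (psum (runs_lo l)) (psum (runs_hi l)) (size (runs_lo l)) i.
    rewrite /= r0 /= -[i.+1]add1n -[(size (runs_lo l)).+1]add1n.
    by apply: (@excursion_gain_shift _ _ _ _ 0 0).
  rewrite lhl; split=> H i.
    case: i => [|i]; first by lia.
    move=> it; have il : i < size (runs_lo l) by move: it; rewrite /= r0.
    apply/sh; first exact: ltnW.
    exact: H.
  move=> il; apply/sh; first exact: ltnW.
  by apply: H; rewrite /= r0.
have -> : left_heavy (Node l r) =
    left_heavy r && (left_heavy l && (size (runs_lo l) <= sumn (runs_lo l))).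
  by rewrite /= andbCA.
have sr : 0 < size (runs_lo r) by rewrite size_runs_lo_gt0.
have sh i : i <= size (runs_lo l) ->
    excursion_gain (psum (runs_lo (Node l r))) (psum (runs_hi (Node l r)))
      (size (runs_lo (Node l r))) (size (runs_lo r) + i) <->
    excursion_gain (psum (runs_lo l)) (psum (runs_hi l)) (size (runs_lo l)) i.
  rewrite size_runs_lo_node //.
  apply: (@excursion_gain_shift _ _ _ _ (sumn (runs_lo r)).+1 (sumn (runs_lo r)).+1) => e _.
    rewrite psum_runs_lo // addKn psum_runs_lo_size ?leq_addr //.
    by have -> : 0 < size (runs_lo r) + e by lia.
  by rewrite psum_runs_hi // addKn psum_runs_hi_size ?leq_addr.
have plo e : 0 < e <= size (runs_lo r) ->
    psum (runs_lo (Node l r)) e = (psum (runs_lo r) e).+1.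
  move=> /andP[e0 er]; rewrite psum_runs_lo // e0.
  have -> : e - size (runs_lo r) = 0 by lia.
  by rewrite psum0; lia.
have phi e : e <= size (runs_lo r) ->
    psum (runs_hi (Node l r)) e = (e == size (runs_lo r)) + psum (runs_hi r) e.
  move=> er; rewrite psum_runs_hi //.
  have -> : e - size (runs_lo r) = 0 by lia.
  by rewrite psum0; lia.
have dom := psum_runs_le r.
have eqr : psum (runs_hi r) (size (runs_lo r)) = psum (runs_lo r) (size (runs_lo r)).
  by rewrite psum_runs_hi_size // psum_runs_lo_size.
have low i : 0 < i < size (runs_lo r) ->
    excursion_gain (psum (runs_lo (Node l r))) (psum (runs_hi (Node l r)))
      (size (runs_lo (Node l r))) i <->
    excursion_gain (psum (runs_lo r)) (psum (runs_hi r)) (size (runs_lo r)) i.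
  rewrite size_runs_lo_node // => ir; split=> H e ie stop above.
    suff : e + psum (runs_lo (Node l r)) i <= i + psum (runs_lo (Node l r)) e.
      by rewrite !plo; lia.
    apply: H; first by lia.
      right; rewrite !plo ?phi; try lia.
      have [ee|ne] := eqVneq e (size (runs_lo r)).
        by rewrite ee eqr; have := dom i; lia.
      by case: stop; lia.
    move=> t ti; rewrite !plo ?phi; try lia.
    by have := above t ti; lia.
  have er : e <= size (runs_lo r).
    rewrite leqNgt; apply/negP => re; have := above (size (runs_lo r)).
    by rewrite !plo ?phi; try lia; rewrite eqr; have := dom i; lia.
  rewrite !plo; try lia.
  suff : e + psum (runs_lo r) i <= i + psum (runs_lo r) e by lia.
  apply: H; first by lia.
    have [ee|ne] := eqVneq e (size (runs_lo r)); [by left|right].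
    by move: stop; rewrite !plo ?phi; try lia; case=> [|]; lia.
  by move=> t ti; have := above t; rewrite !plo ?phi; try lia; move/(_ ti); lia.
split=> [/andP[/IHr hr /lhl hl] i it|H].
  have [ir|ri] := ltnP i (size (runs_lo r)); first by apply/low; [|apply: hr]; lia.
  rewrite size_runs_lo_node // in it.
  have -> : i = size (runs_lo r) + (i - size (runs_lo r)) by lia.
  by apply/sh; [|apply: hl]; lia.
apply/andP; split.
  apply/IHr => i ir; apply/low => //; apply: H; rewrite size_runs_lo_node //; lia.
apply/lhl => i il; apply/sh; first exact: ltnW.
by apply: H; rewrite size_runs_lo_node //; lia.
Qed.

Lemma run_word_cat g h : run_word (g ++ h) = run_word g ++ run_word h.
Proof. by rewrite /run_word map_cat flatten_cat. Qed.

Lemma gamma_run_word g : gamma (run_word g) = g.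
Proof.
suff downE : down_runs (run_word g) = 0 :: g by rewrite /gamma downE.
elim: g => //= c g IH; rewrite -/(run_word g); congr (_ :: _).
by elim: c => //= c ->.
Qed.

Lemma count_up_run_word g : count_mem up (run_word g) = size g.
Proof. by elim: g => //= c g IH; rewrite count_cat count_nseq IH mul0n. Qed.

Lemma count_down_run_word g : count_mem down (run_word g) = sumn g.
Proof. by elim: g => //= c g IH; rewrite count_cat count_nseq IH mul1n. Qed.

Lemma run_word_prefix g h i : (forall i, i <= size g -> psum g i <= i + h) ->
  count_mem down (take i (run_word g)) <= h + count_mem up (take i (run_word g)).
Proof.
elim: g h i => // c g IH h [|i] dom; first by rewrite take0.
rewrite /= -/(run_word g) take_cat size_nseq; case: ltnP => ic.
  have := dom 1 isT; rewrite /psum /= take0 /= addn0 take_nseq ?(ltnW ic) //.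
  by rewrite !count_nseq /=; lia.
have := IH (1 + h - c) (i - c); rewrite !count_cat !count_nseq /=.
have c1 : c <= 1 + h by have := dom 1 isT; rewrite /psum /= take0 /= addn0.
have prem : forall j, j <= size g -> psum g j <= j + (1 + h - c).
  by move=> j jg; have := dom j.+1 jg; rewrite /psum /=; lia.
by move/(_ prem); rewrite !mul1n !mul0n; lia.
Qed.

Lemma dyck_run_word k g : size g = k -> sumn g = k ->
  (forall i, i <= k -> psum g i <= i) -> dyck k (run_word g).
Proof.
move=> sg smg dom; split; rewrite ?count_up_run_word ?count_down_run_word // => i.
by apply: (@run_word_prefix g 0) => j jg; rewrite addn0 dom // -sg.
Qed.

Lemma dyck_run_wordP k x : dyck k x -> exists g,
  [/\ x = run_word g, size g = k, sumn g = k & forall i, i <= k -> psum g i <= i].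
Proof.
move=> dx; have [sg xE] := dyck_gamma dx; exists (gamma x).
case: dx => _ Dx pre; move: (gamma x) sg xE => g sg; rewrite -/(run_word g) => xE.
rewrite {}xE count_down_run_word in Dx pre *; split=> // i ik.
have := pre (size (run_word (take i g))).
rewrite -[in run_word g](cat_take_drop i g) run_word_cat take_size_cat //.
by rewrite count_up_run_word count_down_run_word size_takel // sg.
Qed.

Lemma psum_sum g j t : 0 < j ->
  psum g j.-1 + \sum_(j <= i < (j + t).+1) entry g i = psum g (j + t).
Proof.
move=> j0; elim: t => [|t IH].
  by rewrite addn0 big_nat1 /entry -psumS prednK.
rewrite addnS big_nat_recr /=; last by lia.
by rewrite addnA IH psumS /entry.
Qed.

Lemma tamari_leP k a b : size a = k -> size b = k -> sumn b = k ->
  dyck k (run_word a) -> dyck k (run_word b) -> (forall i, i <= k -> psum b i <= i) ->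
  tamari_le k (run_word a) (run_word b) <-> tamari_sums (psum a) (psum b) k.
Proof.
move=> sa sb smb dka dkb domb; split=> [le_ab i j /andP[ij jk] bij|tam j jk].
  have ik : 1 <= i.+1 <= k by lia.
  have [+ _] := lonP dka ik; have [_ +] := lonP dkb ik.
  rewrite !gamma_run_word => /(_ (j - i.+1)) minb gaina.
  have lon_le := le_ab _ ik.
  have := psum_sum b (j - i.+1) (ltn0Sn i); rewrite subnKC // => sumb.
  have := psum_sum a (lon i.+1 (run_word a)) (ltn0Sn i) => suma.
  exists (i.+1 + lon i.+1 (run_word a)); last by move: suma => /=; lia.
  rewrite /= in sumb.
  by have := minb _; rewrite subnKC //; lia.
have [/[1!gamma_run_word] gainb _] := lonP dkb jk.
have [_ /[1!gamma_run_word] mina] := lonP dka jk.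
have [_ /[1!gamma_run_word] minb] := lonP dkb jk.
have le_k : lon j (run_word b) <= k - j.
  apply: minb; have := psum_sum b (k - j) (proj1 (andP jk)).
  have := domb j.-1; rewrite subnKC; last by lia.
  by rewrite (@psum_oversize b k) ?sb // smb; lia.
have sumb := psum_sum b (lon j (run_word b)) (proj1 (andP jk)).
have [||m jm gaina] := tam j.-1 (j + lon j (run_word b)).
- by lia.
- by lia.
have suma := psum_sum a (m - j) (proj1 (andP jk)).
have mE : j + (m - j) = m by lia.
rewrite mE in suma.
by have := mina (m - j); rewrite mE; lia.
Qed.

Lemma IntTamari_runs k l : size (runs_lo l) = k -> sumn (runs_lo l) = k ->
  IntTamari k (run_word (runs_lo l), run_word (runs_hi l)) <-> left_heavy l.
Proof.
move=> szl sml; have szh : size (runs_hi l) = k by rewrite size_runs_hi.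
have smh : sumn (runs_hi l) = k by rewrite sumn_runs_hi.
have Ak : psum (runs_lo l) k = k by rewrite psum_oversize ?szl.
have dom i : psum (runs_hi l) i <= psum (runs_lo l) i by exact: psum_runs_le.
split=> [[/= dlo dhi tam]|hl].
  have domlo i : i <= k -> psum (runs_lo l) i <= i.
    have [g [/(congr1 gamma)]] := dyck_run_wordP dlo.
    by rewrite !gamma_run_word => <- _ _; apply.
  have domhi i : i <= k -> psum (runs_hi l) i <= i.
    by move=> ik; apply: leq_trans (dom i) (domlo i ik).
  apply/left_heavy_excursion_gain => i il; rewrite szl.
  apply: tamari_excursion_gain => //; rewrite ?psum0 //; try exact: psum_mono.
  exact/tamari_leP.
have gain i : i < k -> excursion_gain (psum (runs_lo l)) (psum (runs_hi l)) k i.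
  move=> ik; have [->|i0] := posnP i.
    by rewrite -szl; apply/excursion_gain0; rewrite szl sml.
  by rewrite -szl; apply: (left_heavy_excursion_gain l).1; rewrite ?szl ?i0.
have [tam domlo] : tamari_sums (psum (runs_lo l)) (psum (runs_hi l)) k /\
    forall i, i <= k -> psum (runs_lo l) i <= i.
  apply: excursion_gain_tamari; rewrite ?psum0 //.
have domhi i : i <= k -> psum (runs_hi l) i <= i.
  by move=> ik; apply: leq_trans (dom i) (domlo i ik).
have dlo : dyck k (run_word (runs_lo l)) by exact: dyck_run_word.
have dhi : dyck k (run_word (runs_hi l)) by exact: dyck_run_word.
by split=> //; apply/tamari_leP.
Qed.

Lemma IntTamari_tree k x y : IntTamari k (x, y) ->
  exists l, [/\ x = run_word (runs_lo l), y = run_word (runs_hi l),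
    size (runs_lo l) = k & sumn (runs_lo l) = k].
Proof.
move=> [/= dx dy tam].
have [a [xE sa sma doma]] := dyck_run_wordP dx.
have [b [yE sb smb domb]] := dyck_run_wordP dy.
rewrite {}xE {}yE in dx dy tam *.
have {}tam := (tamari_leP sa sb smb dx dy domb).1 tam.
have dom i : psum b i <= psum a i.
  have [ik|ki] := leqP i k; last by rewrite !psum_oversize ?sa ?sb ?sma ?smb // ltnW.
  have pak : psum a k = k by rewrite psum_oversize ?sa.
  exact: (tamari_dominated (psum0 a) (psum0 b) pak (@psum_mono a) (@psum_mono b) tam domb).
have [l loE hiE] := runs_surj (etrans sa (esym sb)) (etrans sma (esym smb)) dom.
by exists l; rewrite loE hiE.
Qed.

Lemma USort132P k w : USort (2 * k + 1) [:: 1; 3; 2] w <->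
  exists l, [/\ w = post_rl 0 (Node l Leaf), left_heavy l,
    size (runs_lo l) = k & sumn (runs_lo l) = k].
Proof.
split=> [[wS [us av]]|[l [-> hl szl sml]]].
  have [t wE] := avoids132_post_rl wS av.
  have pw : is_permutation w.
    rewrite /is_permutation (perm_uniq wS) iota_uniq (perm_mem wS).
    by rewrite mem_iota.
  have wn0 : w != [::] by rewrite -size_eq0 (perm_size wS) size_iota addn1.
  have := uniquely_sorted_full pw wn0 us; rewrite -wE => /full_post_rl[l [tE hl sml]].
  have szw : 2 * k + 1 = bsize t.
    by rewrite -(size_post_rl 0 t) wE (perm_size wS) size_iota.
  rewrite tE /= bsize_runs in szw.
  by exists l; rewrite -tE wE; split=> //; lia.
have szT : bsize (Node l Leaf) = 2 * k + 1 by rewrite /= bsize_runs; lia.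
have wS : Sym (2 * k + 1) (post_rl 0 (Node l Leaf)).
  by have := perm_post_rl 0 (Node l Leaf); rewrite szT.
split=> //; split; last exact: avoids_post_rl.
apply: full_uniquely_sorted; first by apply: left_heavy_full; rewrite ?szl.
by rewrite /is_permutation (perm_uniq wS) iota_uniq mem_post_rl.
Qed.

Lemma swl_post_rl t : swl (post_rl 0 t) = post_lr 0 t.
Proof. by rewrite (swl_slides (perm_post_rl 0 t)) slides_post_rl. Qed.

Theorem theorem6p4 (k : nat) :
  (forall w : seq nat,
      USort (2 * k + 1) [:: 1; 3; 2] w ->
      USort (2 * k + 1) [:: 3; 1; 2] (swl w)) /\
  set_bij (USort (2 * k + 1) [:: 1; 3; 2]) (IntTamari k)
          (fun w : seq nat => DL k (swl w)).
Proof.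
have DLE l : size (runs_lo l) = k -> sumn (runs_lo l) = k ->
    DL k (swl (post_rl 0 (Node l Leaf))) = (run_word (runs_lo l), run_word (runs_hi l)).
  by move=> szl sml; rewrite swl_post_rl DL_post_lr // bsize_runs; lia.
split=> [w /USort132P[l [-> hl szl sml]]|].
  rewrite swl_post_rl.
  have szT : bsize (Node l Leaf) = 2 * k + 1 by rewrite /= bsize_runs; lia.
  have wS : Sym (2 * k + 1) (post_lr 0 (Node l Leaf)).
    by have := perm_post_lr 0 (Node l Leaf); rewrite szT.
  split=> //; split; last exact: avoids_post_lr.
  apply: full_uniquely_sorted.
    apply: (@full_post_lr k); first by rewrite bsize_runs; lia.
    by have [] := (IntTamari_runs szl sml).2 hl.
  by rewrite /is_permutation (perm_uniq wS) iota_uniq mem_post_lr.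
split.
- move=> w /USort132P[l [-> hl szl sml]]; rewrite DLE //.
  exact: (IntTamari_runs szl sml).2.
- move=> w w'; rewrite !in_setE => /USort132P[l [-> _ szl sml]].
  move=> /USort132P[l' [-> _ szl' sml']]; rewrite !DLE //.
  case=> /(congr1 gamma) + /(congr1 gamma); rewrite !gamma_run_word => lo hi.
  by rewrite (runs_inj lo hi).
move=> [x y] xy; have [l [xE yE szl sml]] := IntTamari_tree xy.
exists (post_rl 0 (Node l Leaf)); last by rewrite DLE // -xE -yE.
by apply/USort132P; exists l; split=> //; apply/(IntTamari_runs szl sml); rewrite -xE -yE.
Qed.
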